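(* Let $\varphi:(0,\infty)\to(0,\infty)$ be concave and increasing, and let $T\in\mathcal{I}_n$ be a simplex. Then $$S_\varphi(T)\le \frac{(n+1)^{\frac{n+1}{2}}}{n^{\frac n2-1}(n-1)!}\cdot\varphi\left(\frac1n\right)$$ and $$S_\varphi^{\rm in}(T)\le \frac{n+1}{n}\cdot\varphi\left(\frac{(n+1)^{\frac{n-1}{2}}}{n^{\frac n2-1}(n-1)!}\right).$$ Equality holds in each case if and only if $T$ is regular.
   Context: $\mathcal{P}_n$ is the family of all convex polytopes in $\mathbb{R}^n$ that contain the origin $o$ in their interiors. $\mathcal{I}_n$ is the set of polytopes in $\mathcal{P}_n$ inscribed in the unit sphere $\mathbb{S}^{n-1}$ centered at $o$ (all vertices lie on $\mathbb{S}^{n-1}$). For a polytope $Q$ with facets $F_1,\dots,F_{N_Q}$ and a point $x$, $\operatorname{dist}(x,F_j)$ is the distance from $x$ to the affine hull of $F_j$, and $\operatorname{vol}_{n-1}(F_j)$ is the $(n-1)$-dimensional volume of $F_j$. For a function $g:(0,\infty)\to(0,\infty)$ (convex or concave) and $Q\in\mathcal{P}_n$, $$S_g(Q):=\sum_{j=1}^{N_Q}g(\operatorname{dist}(o,F_j))\operatorname{vol}_{n-1}(F_j).$$ If moreover $Q$ admits an insphere tangent to each facet of $Q$ (as every simplex does), with center (incenter) $i_Q$, then $$S_g^{\rm in}(Q):=\sum_{j=1}^{N_Q}\operatorname{dist}(i_Q,F_j)\,g(\operatorname{vol}_{n-1}(F_j)).$$ *)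

(* Defs.v *)
From HB Require Import structures.
From mathcomp Require Import all_boot all_order all_algebra.
From mathcomp Require Import all_classical all_reals all_analysis.

Set Implicit Arguments.
Unset Strict Implicit.
Unset Printing Implicit Defensive.

Import Order.TTheory GRing.Theory Num.Theory.
Import numFieldNormedType.Exports.

Local Open Scope classical_set_scope.
Local Open Scope ring_scope.

Section EuclideanSpace.
Context {R : realType}.

Definition dotv n (u v : 'rV[R]_n) : R := \sum_(i < n) u 0 i * v 0 i.

(* The library norm of 'rV[R]_n is the sup norm; metric notions below use this
   one.  Both induce the same topology. *)
Definition enorm n (u : 'rV[R]_n) : R := Num.sqrt (dotv u u).

Definition set_dist n (x : 'rV[R]_n) (A : set 'rV[R]_n) : R :=
  inf [set enorm (x - y) | y in A].

Definition affine_set n (A : set 'rV[R]_n) : Prop :=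
  forall x y (t : R), A x -> A y -> A (t *: x + (1 - t) *: y).

Definition affine_hull n (A : set 'rV[R]_n) : set 'rV[R]_n :=
  smallest (@affine_set n) A.

Definition convex_hull n (A : set 'rV[R]_n) : set 'rV[R]_n :=
  smallest (@convex_set R 'rV[R]_n) A.

Definition affinely_independent n k (p : 'I_k -> 'rV[R]_n) : Prop :=
  forall a : 'I_k -> R,
    \sum_i a i = 0 -> \sum_i a i *: p i = 0 -> forall i, a i = 0.

Definition has_affdim n (A : set 'rV[R]_n) (k : nat) : Prop :=
  (exists p : 'I_k.+1 -> 'rV[R]_n, range p `<=` A /\ affinely_independent p) /\
  (forall p : 'I_k.+2 -> 'rV[R]_n, range p `<=` A -> ~ affinely_independent p).

(* Lebesgue measure on R^m as the m-fold product measure, each product being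
   computed by slicing off the first coordinate as in [product_measure1]; on
   'rV_0 it is the unit mass.  It is meant for Borel sets (here: polytopes). *)
Fixpoint lebesgue_rV (m : nat) : set 'rV[R]_m -> \bar R :=
  match m return set 'rV[R]_m -> \bar R with
  | 0 => fun A => (\1_A (0 : 'rV[R]_0))%:E
  | k.+1 => fun A =>
      (\int[lebesgue_measure]_x
         lebesgue_rV [set y : 'rV[R]_k | A (row_mx (const_mx x : 'rV_1) y)])%E
  end.

(* k-dimensional volume of a set F lying in a k-dimensional affine subspace of
   R^n: Lebesgue measure of F in an isometric chart z |-> z *m B + c of that
   subspace (the rows of B are orthonormal).  All admissible charts give the
   same value, so that the supremum is their common value. *)
Definition kvol n (k : nat) (F : set 'rV[R]_n) : R :=
  fine (ereal_sup
    [set v | exists (B : 'M[R]_(k, n)) (c : 'rV[R]_n),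
       [/\ B *m B^T = 1%:M,
           F `<=` range (fun z : 'rV[R]_k => z *m B + c) &
           v = lebesgue_rV [set z : 'rV[R]_k | F (z *m B + c)]]]).

Definition polytope n (P : set 'rV[R]_n) : Prop :=
  exists2 V : set 'rV[R]_n, finite_set V & P = convex_hull V.

Definition face n (P F : set 'rV[R]_n) : Prop :=
  exists (u : 'rV[R]_n) (b : R),
    (forall x, P x -> dotv u x <= b) /\ F = [set x | P x /\ dotv u x = b].

Definition facets n (P : set 'rV[R]_n) : set (set 'rV[R]_n) :=
  [set F | face P F /\ has_affdim F n.-1].

Definition vertices n (P : set 'rV[R]_n) : set 'rV[R]_n :=
  [set x | face P [set x]].

Definition polytope_o n (P : set 'rV[R]_n) : Prop := polytope P /\ P° 0.

Definition inscribed_polytope_o n (P : set 'rV[R]_n) : Prop :=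
  polytope_o P /\ forall x, vertices P x -> enorm x = 1.

Definition spanned_simplex n (v : 'I_n.+1 -> 'rV[R]_n) (T : set 'rV[R]_n) :
  Prop := affinely_independent v /\ T = convex_hull (range v).

Definition simplex n (T : set 'rV[R]_n) : Prop :=
  exists v : 'I_n.+1 -> 'rV[R]_n, spanned_simplex v T.

Definition regular_simplex n (T : set 'rV[R]_n) : Prop :=
  exists v : 'I_n.+1 -> 'rV[R]_n, spanned_simplex v T /\
    exists l : R, forall i j, i != j -> enorm (v i - v j) = l.

(* Since the ball lies in P, a sphere meeting a facet is tangent to it. *)
Definition insphere n (P : set 'rV[R]_n) (c : 'rV[R]_n) (r : R) : Prop :=
  [/\ 0 < r,
      [set x | enorm (x - c) <= r] `<=` P &
      forall F, facets P F -> exists2 x, F x & enorm (x - c) = r].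

(* The insphere of P is unique when it exists; otherwise the value is junk. *)
Definition incenter n (P : set 'rV[R]_n) : 'rV[R]_n :=
  get [set c | exists r, insphere P c r].

Definition Sg n (g : R -> R) (Q : set 'rV[R]_n) : R :=
  \sum_(F \in facets Q) g (set_dist 0 (affine_hull F)) * kvol n.-1 F.

Definition Sg_in n (g : R -> R) (Q : set 'rV[R]_n) : R :=
  \sum_(F \in facets Q) set_dist (incenter Q) (affine_hull F) * g (kvol n.-1 F).

Definition concave_function (D : set R) (f : R -> R) : Prop :=
  convex_function (D : set (convex_lmodType R^o)) (fun x => - f x).

End EuclideanSpace.

(* Main.v *)
Require Import Defs.
From HB Require Import structures.
From mathcomp Require Import all_boot all_order all_algebra.
From mathcomp Require Import all_classical all_reals all_analysis measurable_realfun.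
From mathcomp Require Import ring lra.

Set Implicit Arguments.
Unset Strict Implicit.
Unset Printing Implicit Defensive.

Import Order.TTheory GRing.Theory Num.Theory.
Import numFieldNormedType.Exports.

Local Open Scope classical_set_scope.
Local Open Scope ring_scope.

(** Let [T] be the simplex with unit vertices [v_0, ..., v_n], write [l_j] for
    its barycentric coordinates and [g_j] for their gradients, and put
    [s = sum_j |g_j|].  Since [l_j] vanishes on the facet [F_j] and equals 1 at
    [v_j], the distance from [x] to the hyperplane of [F_j] is
    [|l_j(x)| / |g_j|]; hence the inradius of [T] is [1 / s], and
    [vol F_j = a |g_j| / (n - 1)!] where [a] is [n!] times the volume of [T],
    the absolute determinant of the matrix with rows [(1, v_j)].  Everything is
    thus a statement about [a] and the vectors [g_j].

    Jensen's inequality, with weights [|g_j|] in the first case and equal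
    weights in the second, bounds the two sums by
    [A phi(1 / s)] and [((n + 1) / s) phi(A / (n + 1))], where
    [A = a s / (n - 1)!] is the surface area.  As [phi] is positive and
    nondecreasing, it remains to prove two inequalities, each with equality only
    for the regular simplex.

    - The inradius is at most [1 / n] ([gradsum_ge], [gradsum_eq]).  The systems
      [g_j] and [v_j] are dual, so [sum_j <g_j, v_j>] is the trace [n] of the
      identity, and each term is at most [|g_j|].  In the equality case [g_j] is
      the multiple [|g_j| v_j] of the vertex, and the relations
      [<g_j, v_i> = - l_j(0)] make all edges equally long.

    - The area is at most that of the regular simplex ([area_le],
      [area_eq_equidistant]).  Let [S] be the scatter matrix of the vertices about
      their centroid.  Then [a^2 = (n + 1) det S], while the Gram-type matrix
      [sum_j g_j^T g_j] is [S^-1]; therefore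
      [(a s)^2 <= (n + 1) a^2 sum_j |g_j|^2 = (n + 1)^2 tr (adj S)].
      The trace of the adjugate of a positive definite matrix is controlled by its
      trace: Hadamard's inequality for the principal minors ([hadamard]) reduces
      to the diagonal, where Maclaurin's inequality ([maclaurin]) applies.  The
      trace of [S] is [(n + 1)(1 - |c|^2)] with [c] the centroid.  For [n >= 3]
      equality makes [S] scalar and [c = 0], which is the regular simplex; for
      [n = 2] the scatter matrix is not determined, but equality in the first
      step makes the [|g_j|], that is the lengths of the three edges, equal; for
      [n = 1] every simplex is regular.

    The measure-theoretic input is the volume of a simplex ([kvol_facet]).  The
    iterated integral of the volume definition is identified with a product
    measure, and the behaviour of the latter under linear maps ([scales_volume])
    is obtained by eliminating the first column of the matrix. *)

(** * Lebesgue measure on row vectors as a product measure *)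

Section SigmaFiniteProduct.
Context d1 d2 (T1 : measurableType d1) (T2 : measurableType d2) (R : realType).
Variable m1 : {sigma_finite_measure set T1 -> \bar R}.
Variable m2 : {sigma_finite_measure set T2 -> \bar R}.

(** The product measure under a name of its own, to carry the structure of a
    sigma-finite measure. *)
Definition sigma_prod : set (T1 * T2) -> \bar R := (m1 \x m2)%E.

HB.instance Definition _ := Measure.on sigma_prod.

Lemma sigma_prod_sigma_finite : sigma_finite setT sigma_prod.
Proof.
have /sigma_finiteP[F [TF ndF Foo]] := sigma_finiteT m1.
have /sigma_finiteP[G [TG ndG Goo]] := sigma_finiteT m2.
exists (fun n => F n `*` G n).
  rewrite -setXTT TF TG; apply/seteqP; split => -[x y].
    move=> [/= [i _ Fix] [j _ Gjy]]; exists (maxn i j) => //; split => /=.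
      exact: (subsetPset _ _ (ndF _ _ (leq_maxl i j))).
    exact: (subsetPset _ _ (ndG _ _ (leq_maxr i j))).
  by move=> [i _ [/= ? ?]]; split; exists i.
move=> i; have [mF Fi] := Foo i; have [mG Gi] := Goo i.
split; first exact: measurableX.
by rewrite /sigma_prod product_measure1E // lte_mul_pinfty // ge0_fin_numE.
Qed.

HB.instance Definition _ := Measure_isSigmaFinite.Build _ _ _ sigma_prod
  sigma_prod_sigma_finite.

End SigmaFiniteProduct.

(** A measurable type bundled with its display and measure, so that the iterated
    product can be defined by recursion on the dimension. *)
Record sfspace (R : realType) := SFSpace {
  sf_disp : measure_display;
  sf_sort : measurableType sf_disp;
  sf_meas : {sigma_finite_measure set sf_sort -> \bar R} }.

Section IteratedProduct.
Context {R : realType}.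

Fixpoint itprod (k : nat) : sfspace R :=
  match k with
  | 0 => SFSpace [the {sigma_finite_measure set _ -> \bar R} of @dirac _ unit tt R]
  | k'.+1 => SFSpace [the {sigma_finite_measure set _ -> \bar R} of
       sigma_prod (@lebesgue_measure R) (sf_meas (itprod k'))]
  end.

Notation E k := (sf_sort (itprod k)).
Notation mu k := (sf_meas (itprod k)).

Fixpoint to_rV (k : nat) : E k -> 'rV[R]_k :=
  match k return E k -> 'rV[R]_k with
  | 0 => fun _ => 0
  | k'.+1 => fun p => row_mx (const_mx p.1 : 'rV_1) (to_rV p.2)
  end.

Fixpoint of_rV (k : nat) : 'rV[R]_k -> E k :=
  match k return 'rV[R]_k -> E k with
  | 0 => fun _ => tt
  | k'.+1 => fun z => (z 0 0, of_rV (rsubmx (z : 'rV_(1 + k'))))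
  end.

Lemma of_rVK k : cancel (@of_rV k) (@to_rV k).
Proof.
elim: k => [|k IH] z /=; first by rewrite thinmx0.
rewrite IH; apply/rowP => i; rewrite mxE.
case: splitP => j ji.
  by rewrite mxE; congr (z _ _); apply/val_inj; rewrite /= ji (ord1 j).
by rewrite mxE; congr (z _ _); apply/val_inj; rewrite /= ji.
Qed.

(** Row vectors carry the sigma-algebra transported from the iterated product. *)
Definition measurable_rV k (A : set 'rV[R]_k) := measurable (@to_rV k @^-1` A).

(** The recursive definition of the volume slices off the first coordinate
    exactly as the product measure does. *)
Lemma lebesgue_rVE k (A : set 'rV[R]_k) :
  lebesgue_rV A = mu k (@to_rV k @^-1` A).
Proof.
elim: k A => [|k IH] A /=.
  by rewrite diracE indicE; congr (_%:R%:E); rewrite !in_setE.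
apply: eq_integral => x _; rewrite /= IH; congr (mu k _).
by apply/seteqP; split => y; rewrite /xsection /= in_setE.
Qed.

(** The entries of a row with a prepended entry, in dimension [k.+1] rather than
    the convertible [1 + k] of block matrices. *)
Lemma slice_head k (x : R) (y : 'rV[R]_k) (j : 'I_1) :
  (row_mx (const_mx x : 'M[R]_1) y : 'rV[R]_k.+1) 0 (lshift k j) = x.
Proof. by have := row_mxEl (const_mx x : 'M[R]_1) y 0 j; rewrite [RHS]mxE. Qed.

Lemma slice_tail k (x : R) (y : 'rV[R]_k) (j : 'I_k) :
  (row_mx (const_mx x : 'M[R]_1) y : 'rV[R]_k.+1) 0 (rshift 1 j) = y 0 j.
Proof. exact: (row_mxEr (const_mx x : 'M[R]_1) y 0 j). Qed.

Lemma measurable_to_rV k (i : 'I_k) :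
  measurable_fun setT (fun p : E k => to_rV p 0 i).
Proof.
elim: k i => [|k IH] i; first by case: i.
have [j ->|j ->] := split_ordP (i : 'I_(1 + k)).
  apply: (eq_measurable_fun (fun p : E k.+1 => p.1)) => [p _|]; last first.
    exact: measurable_fst.
  symmetry; exact: slice_head.
apply: (eq_measurable_fun (fun p : E k.+1 => to_rV p.2 0 j)) => [p _|].
  symmetry; exact: slice_tail.
exact: (measurableT_comp (IH j) (@measurable_snd _ _ _ _)).
Qed.

Lemma measurable_of_rV d (X : measurableType d) k (h : X -> 'rV[R]_k) :
  (forall i, measurable_fun setT (fun x => h x 0 i)) ->
  measurable_fun setT (fun x => of_rV (h x)).
Proof.
elim: k h => [|k IH] h mh /=; first exact: measurable_cst.
apply: measurable_fun_pair; first exact: mh.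
apply: IH => i; apply: (eq_measurable_fun (fun x => h x 0 (rshift 1 i))).
  by move=> x _; rewrite mxE.
exact: mh.
Qed.

Lemma measurable_rV_affine k l (A : set 'rV[R]_l) (M : 'M[R]_(k, l)) (c : 'rV[R]_l) :
  measurable_rV A -> measurable_rV [set z | A (z *m M + c)].
Proof.
move=> mA; rewrite /measurable_rV.
pose h (p : E k) := of_rV (to_rV p *m M + c).
rewrite (_ : _ @^-1` _ = h @^-1` (@to_rV l @^-1` A)); last first.
  by apply/seteqP; split => p /=; rewrite /h of_rVK.
rewrite -[X in measurable X]setTI.
suff mh : measurable_fun setT h by exact: mh.
apply: measurable_of_rV => i.
apply: (eq_measurable_fun
    (fun p => (\sum_(j < k) (to_rV p 0 j * M j i) + c 0 i)%R)) => [p _|].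
  by rewrite !mxE.
apply: measurable_funD => //; apply: measurable_sum => j.
by apply: measurable_funM => //; exact: measurable_to_rV.
Qed.

Lemma measurable_rV_ge0 k (i : 'I_k) : measurable_rV [set z : 'rV[R]_k | 0 <= z 0 i].
Proof.
rewrite /measurable_rV -[X in measurable X]setTI.
have := @measurable_to_rV k i => /(_ measurableT `[0, +oo[%classic).
rewrite (_ : _ @^-1` `[0, +oo[ = @to_rV k @^-1` [set z : 'rV[R]_k | 0 <= z 0 i]).
  by apply; exact: measurable_itv.
by apply/seteqP; split => p /=; rewrite in_itv/= andbT.
Qed.

Definition std_simplex k (s : R) : set 'rV[R]_k :=
  [set z | (forall i, 0 <= z 0 i) /\ \sum_i z 0 i <= s].

Lemma measurable_rV_std_simplex k s : measurable_rV (@std_simplex k s).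
Proof.
rewrite /measurable_rV (_ : _ @^-1` _ =
    \bigcap_i (@to_rV k @^-1` [set z : 'rV[R]_k | 0 <= z 0 i]) `&`
    @to_rV k @^-1` [set z : 'rV[R]_k |
      [set y : 'rV[R]_1 | 0 <= y 0 0] (z *m const_mx (-1) + const_mx s)]).
  apply: measurableI.
    apply: fin_bigcap_measurable => //; move=> i _; exact: measurable_rV_ge0.
  exact/measurable_rV_affine/measurable_rV_ge0.
have sE (z : 'rV[R]_k) : (0 <= (z *m const_mx (-1) + const_mx s) 0 (0 : 'I_1)) =
    (\sum_i z 0 i <= s).
  rewrite !mxE (eq_bigr (fun i => - z 0 i)) => [|i _]; last by rewrite mxE mulrN1.
  by rewrite sumrN addrC subr_ge0.
apply/seteqP; split => p /=.
  by move=> [p0 ps]; split => [i _|]; rewrite ?sE //=; exact: p0.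
by rewrite sE => -[p0 ps]; split => // i; exact: p0.
Qed.

Definition slice k (A : set 'rV[R]_k.+1) (x : R) : set 'rV[R]_k :=
  [set y : 'rV[R]_k | A (row_mx (const_mx x : 'rV_1) y)].

Lemma xsection_to_rV k (A : set 'rV[R]_k.+1) x :
  xsection (@to_rV k.+1 @^-1` A) x = @to_rV k @^-1` slice A x.
Proof. by apply/seteqP; split => y; rewrite /xsection /= in_setE. Qed.

Lemma measurable_rV_slice k (A : set 'rV[R]_k.+1) x : measurable_rV A -> measurable_rV (slice A x).
Proof. by move=> mA; rewrite /measurable_rV -xsection_to_rV; exact: measurable_xsection. Qed.

Lemma measurable_slice k (A : set 'rV[R]_k.+1) : measurable_rV A ->
  measurable_fun setT (fun x : measurableTypeR R => lebesgue_rV (slice A x)).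
Proof.
move=> mA; apply: (eq_measurable_fun (mu k \o xsection (@to_rV k.+1 @^-1` A))).
  by move=> x _; rewrite /= lebesgue_rVE xsection_to_rV.
exact: measurable_fun_xsection.
Qed.

Lemma lebesgue_rV_ge0 k (A : set 'rV[R]_k) : (0 <= lebesgue_rV A)%E.
Proof. by rewrite lebesgue_rVE measure_ge0. Qed.

End IteratedProduct.

Arguments std_simplex {R} k s _.

(** * Volume under affine maps *)

Section ChangeOfVariables.
Context {R : realType}.
Notation leb := (@lebesgue_measure R).

Lemma row_mx1D k (x : R) (y : 'rV[R]_k) (c : 'rV[R]_k.+1) :
  row_mx (const_mx x : 'M[R]_1) y + c =
  row_mx (const_mx (x + c 0 0)) (y + rsubmx (c : 'rV_(1 + k))).
Proof.
rewrite -[in LHS](@hsubmxK _ 1 1 k c) (@add_row_mx _ 1 1 k); congr row_mx.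
by apply/rowP => i; rewrite !mxE; congr (_ + c _ _); apply/val_inj; rewrite /= (ord1 i).
Qed.

Lemma mul_row1_block k (x a : R) (y b : 'rV[R]_k) (c : 'cV[R]_k) (D : 'M[R]_k) :
  row_mx (const_mx x : 'M[R]_1) y *m block_mx (a%:M : 'M[R]_1) b c D =
  row_mx (const_mx (x * a + (y *m c) 0 0) : 'M[R]_1) (x *: b + y *m D).
Proof.
rewrite mul_row_block; congr row_mx.
  by apply/rowP => i; rewrite (ord1 i) !mxE big_ord1 !mxE eqxx.
by congr (_ + _); apply/rowP => i; rewrite !mxE big_ord1 !mxE.
Qed.

Lemma measurable_affine_line (a b : R) :
  measurable_fun setT (fun x : measurableTypeR R => (a * x + b : measurableTypeR R)).
Proof. by apply: measurable_funD => //; exact: measurable_funM. Qed.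

(** Uniqueness of Lebesgue measure reduces this to intervals. *)
Lemma lebesgue_measure_affine (a b : R) (A : set (measurableTypeR R)) : a != 0 ->
  measurable A -> leb A = (`|a|%:E * leb [set x | A (a * x + b)%R])%E.
Proof.
move=> a0 mA.
pose na : {nonneg R} := NngNum (normr_ge0 a).
pose f := fun x : measurableTypeR R => (a * x + b : measurableTypeR R).
have mf : measurable_fun setT f := measurable_affine_line a b.
pose pf : {measure set (measurableTypeR R) -> \bar R} := pushforward leb f.
pose m : {measure set (measurableTypeR R) -> \bar R} := mscale na (pf mf).
rewrite (_ : (_ * _)%E = m A) //.
apply: lebesgue_measure_unique => // X [[p q] _ <-].
transitivity (`|a|%:E * leb (f @^-1` `]p, q]))%E; last by [].
have [a_gt0|a_lt0|aE] := ltgtP 0 a; last by rewrite -aE eqxx in a0.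
  rewrite (_ : f @^-1` _ = `](p - b) / a, (q - b) / a]%classic); last first.
    apply/seteqP; split => x; rewrite /f /= !in_itv/=.
      by move=> /andP[? ?]; rewrite ltr_pdivrMr // ler_pdivlMr //; apply/andP; split; lra.
    by rewrite ltr_pdivrMr // ler_pdivlMr // => /andP[? ?]; apply/andP; split; lra.
  rewrite !lebesgue_measure_itv /= !lte_fin ltr_pM2r ?invr_gt0 // ltrD2r.
  case: ifPn => _; last by rewrite mule0.
  by rewrite gtr0_norm // -!EFinD -EFinM; congr _%:E; field; rewrite gt_eqF.
rewrite (_ : f @^-1` _ = `[(q - b) / a, (p - b) / a[%classic); last first.
  apply/seteqP; split => x; rewrite /f /= !in_itv/=.
    by move=> /andP[? ?]; rewrite ltr_ndivlMr // ler_ndivrMr //; apply/andP; split; lra.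
  by rewrite ltr_ndivlMr // ler_ndivrMr // => /andP[? ?]; apply/andP; split; lra.
rewrite !lebesgue_measure_itv /= !lte_fin ltr_nM2r ?invr_lt0 // ltrD2r.
case: ifPn => _; last by rewrite mule0.
by rewrite ltr0_norm // -!EFinD -EFinM; congr _%:E; field; rewrite lt_eqF.
Qed.

Lemma integral_affine_line (a b : R) (f : measurableTypeR R -> \bar R) : a != 0 ->
  measurable_fun setT f -> (forall x, 0 <= f x)%E ->
  (\int[leb]_x f x = `|a|%:E * \int[leb]_x f (a * x + b)%R)%E.
Proof.
move=> a0 mf f0.
pose na : {nonneg R} := NngNum (normr_ge0 a).
pose h := fun x : measurableTypeR R => (a * x + b : measurableTypeR R).
have mh : measurable_fun setT h := measurable_affine_line a b.
pose pf : {measure set (measurableTypeR R) -> \bar R} := pushforward leb h.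
transitivity (\int[mscale na (pf mh)]_x f x)%E.
  apply: eq_measure_integral => A mA _.
  exact: (lebesgue_measure_affine b a0 mA).
rewrite ge0_integral_mscale //=; congr (_ * _)%E.
by rewrite ge0_integral_pushforward.
Qed.

Lemma lebesgue_rVS k (A : set 'rV[R]_k.+1) :
  lebesgue_rV A = (\int[leb]_x lebesgue_rV (slice A x))%E.
Proof. by []. Qed.

Lemma lebesgue_rV_translate k (A : set 'rV[R]_k) (c : 'rV[R]_k) : measurable_rV A ->
  lebesgue_rV [set z | A (z + c)] = lebesgue_rV A.
Proof.
elim: k A c => [|k IH] A c mA.
  by congr lebesgue_rV; apply/seteqP; split => z /=;
    have -> : z + c = z by apply/rowP => -[].
rewrite !lebesgue_rVS.
rewrite [RHS](@integral_affine_line 1 (c 0 0) _) ?oner_eq0 //; first last.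
- by move=> x; exact: lebesgue_rV_ge0.
- exact: measurable_slice.
rewrite normr1 mul1e; apply: eq_integral => x _.
rewrite mul1r -[RHS](IH _ (rsubmx (c : 'rV_(1 + k)))); last exact: measurable_rV_slice.
by congr lebesgue_rV; apply/seteqP; split => y; rewrite /slice /= row_mx1D.
Qed.

Definition scales_volume k (M : 'M[R]_k) := forall A : set 'rV[R]_k, measurable_rV A ->
  lebesgue_rV A = (`|\det M|%:E * lebesgue_rV [set z | A (z *m M)])%E.

Lemma measurable_rV_lin k (A : set 'rV[R]_k) (M : 'M[R]_k) :
  measurable_rV A -> measurable_rV [set z | A (z *m M)].
Proof.
move=> /(measurable_rV_affine M 0); congr measurable_rV.
by apply/seteqP; split => z /=; rewrite addr0.
Qed.

Lemma scales_volume_mul k (M N : 'M[R]_k) :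
  scales_volume M -> scales_volume N -> scales_volume (M *m N).
Proof.
move=> sM sN A mA; rewrite (sN _ mA) (sM _ (measurable_rV_lin N mA)) muleA -EFinM.
rewrite det_mulmx normrM [X in X%:E]mulrC; congr (_ * lebesgue_rV _)%E.
by apply/seteqP; split => z /=; rewrite mulmxA.
Qed.

(** The image of a slice under a block upper triangular map is a translate of a
    slice: the first coordinate is only rescaled, and the map acts inside the
    slice by [D]. *)
Lemma scales_volume_upper k (a : R) (b : 'rV[R]_k) (D : 'M[R]_k) : a != 0 ->
  scales_volume D -> scales_volume (block_mx (a%:M : 'M[R]_1) b 0 D : 'M[R]_(1 + k)).
Proof.
move=> a0 sD A mA; rewrite !lebesgue_rVS.
rewrite (@integral_affine_line a 0 _) //; first last.
- by move=> x; exact: lebesgue_rV_ge0.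
- exact: measurable_slice.
rewrite det_ublock det_scalar1 normrM EFinM -muleA; congr (_ * _)%E.
rewrite -ge0_integralZl_EFin //; first last.
- apply: measurable_slice; exact: measurable_rV_lin.
- by move=> x _; exact: lebesgue_rV_ge0.
apply: eq_integral => x _.
rewrite addr0 -[LHS](lebesgue_rV_translate (x *: b)); last exact: measurable_rV_slice.
rewrite sD; last first.
  by have := measurable_rV_affine 1%:M (x *: b) (measurable_rV_slice (a * x) mA);
    congr measurable_rV; apply/seteqP; split => y /=; rewrite mulmx1.
congr (_ * lebesgue_rV _)%E.
by apply/seteqP; split => y; rewrite /slice /= mul_row1_block mulmx0 mxE addr0
  [a * x]mulrC [y *m D + _]addrC.
Qed.

(** A shear of the first coordinate along the others translates every line
    parallel to the first axis; this is the one place where the order of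
    integration has to be exchanged. *)
Lemma scales_volume_shear k (c : 'cV[R]_k) :
  scales_volume (block_mx (1%:M : 'M[R]_1) 0 c 1%:M : 'M[R]_(1 + k)).
Proof.
move=> A mA.
set M := block_mx _ _ _ _.
have tonelli (B : set 'rV[R]_k.+1) : measurable_rV B -> lebesgue_rV B =
    (\int[sf_meas (itprod k)]_y leb [set x | B (row_mx (const_mx x : 'M[R]_1) (to_rV y))])%E.
  move=> mB; rewrite lebesgue_rVE.
  transitivity ((leb \x^ sf_meas (itprod k)) (@to_rV R k.+1 @^-1` B))%E.
    by apply: product_measure_unique => // X Y mX mY; exact: product_measure2E.
  apply: eq_integral => y _; congr (leb _).
  by apply/seteqP; split => x; rewrite /ysection /= in_setE.
rewrite det_lblock !det1 mulr1 normr1 mul1e !tonelli //; last exact: measurable_rV_lin.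
apply: eq_integral => y _.
have mS : measurable [set x : measurableTypeR R | A (row_mx (const_mx x : 'M[R]_1) (to_rV y))].
  have := measurable_ysection y mA; congr measurable.
  by apply/seteqP; split => x; rewrite /ysection /= in_setE.
rewrite (@lebesgue_measure_affine 1 ((to_rV y *m c) 0 0) _ (oner_neq0 _) mS).
rewrite normr1 mul1e; congr (leb _); apply/seteqP; split => x /=;
  by rewrite mul_row1_block mul1r mulr1 scaler0 add0r mulmx1.
Qed.

(** Elimination: when the corner entry is nonzero the matrix is a shear times a
    block upper triangular one.  Otherwise some entry of the first column is
    nonzero and an elementary row operation, itself upper triangular, moves it
    into the corner. *)
Lemma scales_volume_unit k (M : 'M[R]_k) : M \in unitmx -> scales_volume M.
Proof.
elim: k M => [|k IH] M uM.
  move=> A mA; rewrite det_mx00 normr1 mul1e; congr lebesgue_rV.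
  by apply/seteqP; split => z /=; have -> : z *m M = z by apply/rowP => -[].
have pivot (N : 'M[R]_(1 + k)) : N \in unitmx -> N 0 0 != 0 -> scales_volume N.
  move=> uN N00.
  pose a := N 0 0; pose b := ursubmx N; pose c := dlsubmx N; pose D := drsubmx N.
  have ulE : ulsubmx N = a%:M.
    apply/rowP => i; rewrite (ord1 i) !mxE eqxx mulr1n /a; congr (N _ _); exact/val_inj.
  pose D' := D - a^-1 *: (c *m b).
  have NE : N = block_mx (1%:M : 'M[R]_1) 0 (a^-1 *: c) 1%:M *m block_mx (a%:M : 'M[R]_1) b 0 D'.
    rewrite mulmx_block !mul1mx !mul0mx !addr0 -[LHS]submxK ulE; congr block_mx.
      by rewrite mul_mx_scalar scalerA divff // scale1r.
    by rewrite -scalemxAl addrC subrK.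
  rewrite NE; apply: scales_volume_mul; first exact: scales_volume_shear.
  apply: scales_volume_upper => //; apply: IH.
  move: uN; rewrite NE unitmx_mul => /andP[_].
  by rewrite unitmxE det_ublock unitrM -unitmxE -unitmxE => /andP[].
have [M00|M00] := eqVneq ((M : 'M[R]_(1 + k)) 0 0) 0; last exact: pivot.
have [i Mi0] : exists i : 'I_k, (M : 'M[R]_(1 + k)) (rshift 1 i) 0 != 0.
  apply/existsP; apply: contraLR uM; rewrite negb_exists => /forallP M0.
  rewrite unitmxE unitfE negbK (expand_det_col M 0) big1 // => j _.
  suff -> : M j 0 = 0 by rewrite mul0r.
  have [j' ->|j' ->] := split_ordP (j : 'I_(1 + k)).
    by rewrite (ord1 j') -[RHS]M00; congr (M _ _); exact/val_inj.
  by have := M0 j'; rewrite negbK => /eqP.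
pose U (x : R) : 'M[R]_(1 + k) := block_mx (1%:M : 'M[R]_1) (x *: delta_mx 0 i) 0 1%:M.
have UU : U (-1) *m U 1 = 1%:M.
  rewrite mulmx_block !mul1mx !mulmx1 !mul0mx !mulmx0 !addr0 !add0r scaleN1r scale1r.
  by rewrite subrr -scalar_mx_block.
have uU x : U x \in unitmx by rewrite unitmxE det_ublock !det1 mulr1 unitr1.
have -> : M = U (-1) *m (U 1 *m M) by rewrite mulmxA UU mul1mx.
apply: scales_volume_mul.
  by apply: scales_volume_upper; [exact: oner_neq0|apply: IH; exact: unitmx1].
apply: pivot; first by rewrite unitmx_mul uU.
have UM (N : 'M[R]_(1 + k)) : (U 1 *m N) 0 0 = N 0 0 + N (rshift 1 i) 0.
  rewrite /U -{1}[N]submxK mulmx_block mul1mx scale1r -rowE.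
  have -> : (0 : 'I_(1 + k)) = lshift k 0 by exact/val_inj.
  by rewrite block_mxEul !mxE.
by have := UM M; rewrite M00 add0r => ->.
Qed.
End ChangeOfVariables.

(** * Volume of the standard simplex *)

Section SimplexVolume.
Context {R : realType}.
Notation leb := (@lebesgue_measure R).

Lemma integral_simplex_slices (k : nat) (s : R) : 0 <= s ->
  (\int[leb]_(x in `[0%R, s]) ((s - x) ^+ k / k`!%:R)%:E)%E =
  (s ^+ k.+1 / k.+1`!%:R)%:E.
Proof.
rewrite le_eqVlt => /predU1P[<-|s0].
  by rewrite set_itv1 integral_set1 expr0n /= mul0r.
(* The integrand and its antiderivative as polynomials. *)
pose q : {poly R} := (k`!%:R)^-1 *: (s%:P - 'X) ^+ k.
pose p : {poly R} := - ((k.+1`!%:R)^-1 *: (s%:P - 'X) ^+ k.+1).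
have p'q : p^`() = q.
  rewrite /p /q derivN derivZ deriv_exp derivB derivC derivX sub0r mulN1r /=.
  rewrite mulNrn scalerN opprK -[_ ^+ k *+ _]scaler_nat scalerA factS natrM invfM.
  by rewrite mulrAC mulVf ?mul1r // pnatr_eq0.
have cp (r : {poly R}) : continuous (horner r).
  by move=> x; apply: differentiable_continuous; apply/derivable1_diffP; case: (is_derive_poly r x).
transitivity (\int[leb]_(x in `[0%R, s]) (q.[x])%:E)%E.
  by apply: eq_integral => x _; rewrite !hornerE mulrC.
rewrite (@continuous_FTC2 _ _ (horner p)) //.
- by rewrite !hornerE subrr subr0 expr0n /= mulr0 oppr0 add0r opprK mulrC.
- by apply: continuous_subspaceT; exact: cp.
- split.
  + by move=> x _; case: (is_derive_poly p x).
  + by apply: cvg_at_right_filter; exact: cp.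
  + by apply: cvg_at_left_filter; exact: cp.
- by move=> x _; rewrite derive1E -p'q; case: (is_derive_poly p x).
Qed.

(** The slice at height [x] of the simplex of size [s] is the simplex of size
    [s - x]. *)
Lemma lebesgue_std_simplex (k : nat) (s : R) : 0 <= s ->
  lebesgue_rV (std_simplex k s) = (s ^+ k / k`!%:R)%:E.
Proof.
elim: k s => [|k IH] s s0.
  rewrite /= indicE mem_set ?expr0 ?fact0 ?divr1 //.
  by split => [[]//|]; rewrite big_ord0.
rewrite lebesgue_rVS -integral_simplex_slices // [RHS]integral_mkcond.
apply: eq_integral => x _; rewrite patchE.
have sumE (y : 'rV[R]_k) :
    \sum_i (row_mx (const_mx x : 'M[R]_1) y) 0 i = x + \sum_i y 0 i.
  rewrite big_split_ord /= big_ord1 row_mxEl mxE; congr (_ + _).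
  by apply: eq_bigr => i _; rewrite row_mxEr.
have sliceE : slice (std_simplex k.+1 s) x =
    [set y | 0 <= x /\ std_simplex k (s - x) y].
  apply/seteqP; split => y; rewrite /slice /std_simplex /=.
    move=> [y0]; rewrite (sumE y) => ys; split.
      by have := y0 (lshift k (0 : 'I_1)); rewrite slice_head.
    by split => [i|]; [have := y0 (rshift 1 i); rewrite slice_tail|lra].
  move=> [x0 [y0 ys]]; split; last by rewrite (sumE y); lra.
  move=> i; have [j ->|j ->] := split_ordP (i : 'I_(1 + k)).
    by rewrite slice_head.
  by rewrite slice_tail.
rewrite sliceE; case: ifPn => [|xs].
  rewrite in_setE /= in_itv /= => /andP[x0 xs].
  rewrite -IH ?subr_ge0 //; congr lebesgue_rV.
  by apply/seteqP; split => y /=; [case|].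
rewrite (_ : [set _ | _] = set0) ?lebesgue_rVE ?preimage_set0 ?measure0 //.
apply/seteqP; split => y //= -[x0 [y0 ys]]; case/negP: xs.
rewrite in_setE /= in_itv /= x0 -subr_ge0 (le_trans _ ys) //.
by apply: sumr_ge0 => i _; exact: y0.
Qed.

Lemma lebesgue_simplex (k : nat) (E : 'M[R]_k) (c : 'rV[R]_k) : E \in unitmx ->
  lebesgue_rV [set z | exists2 y, std_simplex k 1 y & z = y *m E + c] =
  (`|\det E| / k`!%:R)%:E.
Proof.
move=> uE.
set A := [set z | _].
have AE : A = [set z | std_simplex k 1 (z *m invmx E + - (c *m invmx E))].
  apply/seteqP; split => z; rewrite /A /=.
    by move=> [y y1 ->]; rewrite mulmxDl mulmxK // addrK.
  by move=> h; eexists; first exact: h; rewrite mulmxDl mulNmx !mulmxKV // subrK.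
have mA : measurable_rV A by rewrite AE; apply: measurable_rV_affine; exact: measurable_rV_std_simplex.
rewrite -(lebesgue_rV_translate c) // (scales_volume_unit uE); last first.
  have := measurable_rV_affine 1%:M c mA.
  by congr measurable_rV; apply/seteqP; split => z /=; rewrite mulmx1.
rewrite (_ : [set z | _] = std_simplex k 1).
  by rewrite lebesgue_std_simplex ?ler01 // expr1n div1r -EFinM.
apply/seteqP; split => z; rewrite /A /=.
  by move=> [y y1 /addIr/(can_inj (mulmxK uE)) ->].
by move=> z1; exists z.
Qed.

End SimplexVolume.

(** * The Euclidean norm *)

Section Euclid.
Context {R : realType}.
Implicit Types (n : nat).

Lemma dotvE n (u v : 'rV[R]_n) : dotv u v = (u *m v^T) 0 0.
Proof. by rewrite mxE; apply: eq_bigr => i _; rewrite mxE. Qed.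

Lemma dotvC n (u v : 'rV[R]_n) : dotv u v = dotv v u.
Proof. by apply: eq_bigr => i _; rewrite mulrC. Qed.

Lemma dotvDl n (u v w : 'rV[R]_n) : dotv (u + v) w = dotv u w + dotv v w.
Proof. by rewrite !dotvE mulmxDl mxE. Qed.

Lemma dotvZl n a (u w : 'rV[R]_n) : dotv (a *: u) w = a * dotv u w.
Proof. by rewrite !dotvE -scalemxAl mxE. Qed.

Lemma dotvNl n (u w : 'rV[R]_n) : dotv (- u) w = - dotv u w.
Proof. by rewrite !dotvE mulNmx mxE. Qed.

Lemma dotvBl n (u v w : 'rV[R]_n) : dotv (u - v) w = dotv u w - dotv v w.
Proof. by rewrite dotvDl dotvNl. Qed.

Lemma dotv0l n (w : 'rV[R]_n) : dotv 0 w = 0.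
Proof. by rewrite dotvE mul0mx mxE. Qed.

Lemma dotvDr n (u v w : 'rV[R]_n) : dotv w (u + v) = dotv w u + dotv w v.
Proof. by rewrite dotvC dotvDl ![dotv _ w]dotvC. Qed.

Lemma dotvZr n a (u w : 'rV[R]_n) : dotv w (a *: u) = a * dotv w u.
Proof. by rewrite dotvC dotvZl dotvC. Qed.

Lemma dotvNr n (u w : 'rV[R]_n) : dotv w (- u) = - dotv w u.
Proof. by rewrite dotvC dotvNl dotvC. Qed.

Lemma dotvBr n (u v w : 'rV[R]_n) : dotv w (u - v) = dotv w u - dotv w v.
Proof. by rewrite dotvDr dotvNr. Qed.

Lemma dotv0r n (w : 'rV[R]_n) : dotv w 0 = 0.
Proof. by rewrite dotvC dotv0l. Qed.

Lemma dotv_suml n (I : finType) (f : I -> 'rV[R]_n) w :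
  dotv (\sum_i f i) w = \sum_i dotv (f i) w.
Proof.
by rewrite dotvE mulmx_suml summxE; apply: eq_bigr => i _; rewrite dotvE.
Qed.

Lemma dotv_sumr n (I : finType) (f : I -> 'rV[R]_n) w :
  dotv w (\sum_i f i) = \sum_i dotv w (f i).
Proof. by rewrite dotvC dotv_suml; apply: eq_bigr => i _; rewrite dotvC. Qed.

Definition dotv_lin := (dotvDl, dotvDr, dotvZl, dotvZr, dotvNl, dotvNr).

Lemma dotv_ge0 n (u : 'rV[R]_n) : 0 <= dotv u u.
Proof. by apply: sumr_ge0 => i _; rewrite -expr2 sqr_ge0. Qed.

Lemma dotv_eq0 n (u : 'rV[R]_n) : (dotv u u == 0) = (u == 0).
Proof.
apply/eqP/eqP => [|->]; last exact: dotv0l.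
move=> /(psumr_eq0P (fun i _ => sqr_ge0 (u 0 i))) u0.
by apply/rowP => i; have /eqP := u0 i isT; rewrite mxE sqrf_eq0 => /eqP.
Qed.

Lemma enorm_ge0 n (u : 'rV[R]_n) : 0 <= enorm u.
Proof. exact: sqrtr_ge0. Qed.

Lemma enorm_sqr n (u : 'rV[R]_n) : enorm u ^+ 2 = dotv u u.
Proof. by rewrite sqr_sqrtr ?dotv_ge0. Qed.

Lemma enorm_gt0 n (u : 'rV[R]_n) : (0 < enorm u) = (u != 0).
Proof. by rewrite sqrtr_gt0 lt_def dotv_ge0 dotv_eq0 andbT. Qed.

Lemma enormN n (u : 'rV[R]_n) : enorm (- u) = enorm u.
Proof. by rewrite /enorm !dotv_lin opprK. Qed.

Lemma enormZ n a (u : 'rV[R]_n) : enorm (a *: u) = `|a| * enorm u.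
Proof. by rewrite /enorm !dotv_lin mulrA -expr2 sqrtrM ?sqr_ge0 // sqrtr_sqr. Qed.

Lemma enorm_div n r (u : 'rV[R]_n) : 0 <= r -> 0 < enorm u ->
  enorm ((r / enorm u) *: u) = r.
Proof.
move=> r0 u0; have u0' : enorm u != 0 by rewrite gt_eqF.
by rewrite enormZ normrM normfV !ger0_norm ?enorm_ge0 // divfK.
Qed.

(** Cauchy-Schwarz, from the nonnegativity of the square of
    [|v| u - |u| v]. *)
Lemma dotv_le_enorm n (u v : 'rV[R]_n) : dotv u v <= enorm u * enorm v.
Proof.
have [->|u0] := eqVneq u 0; first by rewrite dotv0l mulr_ge0 ?enorm_ge0.
have [->|v0] := eqVneq v 0; first by rewrite dotv0r mulr_ge0 ?enorm_ge0.
rewrite -enorm_gt0 in u0; rewrite -enorm_gt0 in v0.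
have := dotv_ge0 (enorm v *: u - enorm u *: v).
rewrite !dotv_lin -!enorm_sqr [dotv v u]dotvC.
set s := enorm u in u0 *; set t := enorm v in v0 *; set d := dotv u v => h.
have : 0 <= (s * t) * (s * t - d) by nra.
by rewrite pmulr_rge0 ?mulr_gt0 // subr_ge0.
Qed.

Lemma dotv_eq_enorm n (u v : 'rV[R]_n) : dotv u v = enorm u * enorm v ->
  enorm v *: u = enorm u *: v.
Proof.
move=> uv; apply/eqP; rewrite -subr_eq0 -dotv_eq0 !dotv_lin -!enorm_sqr.
by rewrite [dotv v u]dotvC uv; apply/eqP; ring.
Qed.

End Euclid.

(** * Barycentric coordinates and their gradients *)

Section Barycentric.
Context {R : realType} (n : nat) (v : 'I_n.+1 -> 'rV[R]_n).

(** Homogeneous coordinates turn barycentric combinations into linear ones. *)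
Definition homog (x : 'rV[R]_n) : 'rV[R]_(1 + n) := row_mx (const_mx 1 : 'M[R]_1) x.

Definition vertex_mx : 'M[R]_(1 + n) := \matrix_(i < 1 + n) homog (v i).

Definition bary (x : 'rV[R]_n) (i : 'I_n.+1) : R := (homog x *m invmx vertex_mx) 0 i.

(** The inverse of [vertex_mx] has the barycentric coordinates of the origin as
    its first row, and their gradients as the columns below it. *)
Definition grad (i : 'I_n.+1) : 'rV[R]_n :=
  \row_j invmx vertex_mx (rshift 1 j) i.

Lemma homog_mul (m : nat) (x : 'rV[R]_n) (N : 'M[R]_(1 + n, m)) j :
  (homog x *m N) 0 j = N (lshift n 0) j + \sum_i x 0 i * N (rshift 1 i) j.
Proof.
rewrite mxE big_split_ord /= big_ord1; congr (_ + _).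
  by rewrite row_mxEl mxE mul1r.
by apply: eq_bigr => i _; rewrite row_mxEr.
Qed.

Lemma baryE x i : bary x i = bary 0 i + dotv (grad i) x.
Proof.
rewrite /bary !homog_mul [in X in _ = _ + X + _]big1 => [|j _]; last by rewrite mxE mul0r.
by rewrite addr0; congr (_ + _); apply: eq_bigr => j _; rewrite mxE mulrC.
Qed.

Lemma bary_comb x y t i :
  bary (t *: x + (1 - t) *: y) i = t * bary x i + (1 - t) * bary y i.
Proof. by rewrite (baryE (_ + _)) (baryE x) (baryE y) !dotv_lin; ring. Qed.

Lemma vertex_mx0 i : vertex_mx i (lshift n 0) = 1.
Proof. by rewrite mxE row_mxEl mxE. Qed.

Lemma vertex_mxS i j : vertex_mx i (rshift 1 j) = v i 0 j.
Proof. by rewrite mxE row_mxEr. Qed.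

Hypothesis v_indep : affinely_independent v.

Lemma vertex_mx_unit : vertex_mx \in unitmx.
Proof.
rewrite -row_free_unit -kermx_eq0; apply/eqP/row_matrixP => i.
rewrite row0; have : row i (kermx vertex_mx) *m vertex_mx = 0 by rewrite -row_mul mulmx_ker row0.
move: (row i _) => w /rowP wM.
have w0 : forall j, w 0 j = 0.
  apply: (v_indep (a := fun j => w 0 j)).
    have := wM (lshift n 0); rewrite mxE [RHS]mxE => wl.
    by rewrite -[RHS]wl; apply: eq_bigr => j _; rewrite vertex_mx0 mulr1.
  apply/rowP => l; have := wM (rshift 1 l); rewrite mxE [RHS]mxE => wl.
  by rewrite summxE mxE -[RHS]wl; apply: eq_bigr => j _; rewrite vertex_mxS mxE.
by apply/rowP => j; rewrite w0 mxE.
Qed.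

Lemma bary_homog x : (\row_i bary x i : 'rV[R]_(1 + n)) *m vertex_mx = homog x.
Proof.
rewrite (_ : \row_i _ = homog x *m invmx vertex_mx); first by rewrite mulmxKV // vertex_mx_unit.
by apply/rowP => i; rewrite mxE.
Qed.

Lemma bary_sum x : \sum_i bary x i = 1.
Proof.
have /rowP/(_ (lshift n 0)) := bary_homog x.
rewrite row_mxEl [RHS]mxE mxE => <-; apply: eq_bigr => i _.
by rewrite vertex_mx0 mulr1 mxE.
Qed.

Lemma bary_point x : \sum_i bary x i *: v i = x.
Proof.
apply/rowP => l; have /rowP/(_ (rshift 1 l)) := bary_homog x.
rewrite row_mxEr mxE summxE => <-; apply: eq_bigr => i _.
by rewrite vertex_mxS !mxE.
Qed.

Lemma bary_unique (a : 'I_n.+1 -> R) x :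
  \sum_i a i = 1 -> \sum_i a i *: v i = x -> bary x =1 a.
Proof.
move=> a1 ax i; apply/eqP; rewrite -subr_eq0; apply/eqP.
apply: (v_indep (a := fun i => bary x i - a i)).
  by rewrite sumrB a1 bary_sum subrr.
under eq_bigr do rewrite scalerBl.
by rewrite sumrB ax bary_point subrr.
Qed.

Lemma bary_vertex i j : bary (v i) j = (i == j)%:R.
Proof.
apply: (bary_unique (a := fun j => (i == j)%:R)).
  by rewrite (bigD1 i) //= eqxx big1 ?addr0 // => l /negPf; rewrite eq_sym => ->.
rewrite (bigD1 i) //= eqxx scale1r big1 ?addr0 // => l /negPf.
by rewrite eq_sym => ->; rewrite scale0r.
Qed.

Lemma grad_sum : \sum_i grad i = 0.
Proof.
have b (x : 'rV[R]_n) : dotv (\sum_i grad i) x = 0.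
  rewrite dotv_suml; have := bary_sum x.
  under eq_bigr do rewrite baryE.
  by rewrite big_split /= bary_sum -[RHS]addr0 => /addrI.
by apply/eqP; rewrite -dotv_eq0 b.
Qed.

(** Subtract the barycentric expansion of the origin from that of [x]: gradients
    and vertices form dual systems. *)
Lemma grad_dual x : \sum_i dotv (grad i) x *: v i = x.
Proof.
transitivity (\sum_i (bary x i *: v i - bary 0 i *: v i)).
  by apply: eq_bigr => i _; rewrite -scalerBl [bary x i]baryE addrAC subrr add0r.
by rewrite sumrB !bary_point subr0.
Qed.

Lemma vertex_dual x : \sum_i dotv (v i) x *: grad i = x.
Proof.
have h y : dotv (\sum_i dotv (v i) x *: grad i) y = dotv x y.
  rewrite dotv_suml -{2}(grad_dual y) dotv_sumr; apply: eq_bigr => i _.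
  by rewrite !dotv_lin mulrC [dotv x _]dotvC.
by apply/eqP; rewrite -subr_eq0 -dotv_eq0 !dotv_lin !h dotvC !h; apply/eqP; ring.
Qed.

Lemma grad_trace : \sum_i dotv (grad i) (v i) = n%:R.
Proof.
transitivity (\sum_i (1 - bary 0 i)); last first.
  rewrite sumrB bary_sum big_const_ord iter_addr_0 -natr1; ring.
apply: eq_bigr => i _; have := bary_vertex i i; rewrite baryE eqxx.
by move=> h; rewrite -[1]h addrC addKr.
Qed.

Lemma grad_neq0 i : (0 < n)%N -> grad i != 0.
Proof.
move=> n0; apply/eqP => g0.
have [j ji] : exists j : 'I_n.+1, j != i.
  case: n n0 i {g0} => [//|m] _ i.
  by exists (lift i ord0); rewrite eq_sym neq_lift.
have := bary_vertex i i; have := bary_vertex j i.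
by rewrite !(baryE (v _)) g0 !dotv0l eqxx (negPf ji) => -> /eqP; rewrite eq_sym oner_eq0.
Qed.

End Barycentric.

(** * Faces of a simplex *)

Section ConvexSets.
Context {R : realType} (n : nat).
Implicit Types C A : set 'rV[R]_n.

Lemma convex_setP C : @convex_set R 'rV[R]_n C <->
  forall x y t, 0 <= t -> t <= 1 -> C x -> C y -> C (t *: x + (1 - t) *: y).
Proof.
split=> [cC x y t t0 t1 Cx Cy|cC x y t].
  by have := cC x y (Itv01 t0 t1); rewrite !in_setE; apply.
by rewrite !in_setE => Cx Cy; exact: cC.
Qed.

Lemma convex_sum C (m : nat) (a : 'I_m.+1 -> R) (p : 'I_m.+1 -> 'rV[R]_n) :
  @convex_set R 'rV[R]_n C -> (forall i, 0 <= a i) -> \sum_i a i = 1 ->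
  (forall i, C (p i)) -> C (\sum_i a i *: p i).
Proof.
move=> /convex_setP cC; elim: m a p => [|m IH] a p a0 a1 Cp.
  by move: a1; rewrite !big_ord1 => ->; rewrite scale1r.
rewrite big_ord_recl; rewrite big_ord_recl in a1.
have rest0 : 0 <= \sum_(i < m.+1) a (lift ord0 i) by apply: sumr_ge0.
have [a1'|a1'] := eqVneq (a ord0) 1.
  rewrite big1 => [|i _]; first by rewrite a1' scale1r addr0.
  have /psumr_eq0P : \sum_(i < m.+1) a (lift ord0 i) = 0 by lra.
  by move=> -> //; rewrite scale0r.
have a1lt : a ord0 < 1 by rewrite lt_neqAle a1' /=; lra.
pose b i := a (lift ord0 i) / (1 - a ord0).
rewrite (_ : \sum_(i < m.+1) _ = (1 - a ord0) *: \sum_i b i *: p (lift ord0 i)).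
  apply: cC => //; first by lra.
  apply: IH => // [i|]; first by rewrite divr_ge0 // subr_ge0 ltW.
  rewrite -mulr_suml (_ : \sum_(i < m.+1) _ = 1 - a ord0); last by lra.
  by rewrite divff // subr_eq0 eq_sym.
rewrite scaler_sumr; apply: eq_bigr => i _; rewrite scalerA; congr (_ *: _).
by rewrite /b mulrC divfK // subr_eq0 eq_sym.
Qed.

End ConvexSets.

Section SimplexFaces.
Context {R : realType} (n : nat) (v : 'I_n.+1 -> 'rV[R]_n).
Hypothesis v_indep : affinely_independent v.

Definition simplex_of : set 'rV[R]_n := [set x | forall i, 0 <= bary v x i].
Definition facet_of (j : 'I_n.+1) : set 'rV[R]_n :=
  [set x | simplex_of x /\ bary v x j = 0].

Lemma simplex_of_vertex i : simplex_of (v i).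
Proof. by move=> j; rewrite bary_vertex // ler0n. Qed.

(** The vertices lie in the convex set where all barycentric coordinates are
    nonnegative, and every point there is a convex combination of them. *)
Lemma convex_hull_simplex : convex_hull (range v) = simplex_of.
Proof.
apply/seteqP; split.
  apply: smallest_sub; last by move=> _ [i _ <-]; exact: simplex_of_vertex.
  apply/convex_setP => x y t t0 t1 Tx Ty i; rewrite bary_comb //.
  by rewrite addr_ge0 // mulr_ge0 // subr_ge0.
move=> x Tx C [cC vC]; rewrite -(bary_point v_indep x).
by apply: convex_sum => // [|i]; [exact: bary_sum|apply: vC; exists i].
Qed.

(** The [i]-th barycentric coordinate is at most 1 on the simplex, and equals 1
    only at [v i]. *)
Lemma vertex_simplex_of i : vertices simplex_of (v i).
Proof.
exists (grad v i), (1 - bary v 0 i).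
have E x : dotv (grad v i) x = bary v x i - bary v 0 i.
  by rewrite [bary v x i]baryE; ring.
have le1 x : simplex_of x -> bary v x i <= 1.
  move=> Tx; rewrite -(bary_sum v_indep x) (bigD1 i) //= lerDl.
  by apply: sumr_ge0.
split=> [x Tx|]; first by rewrite E lerD2r le1.
apply/seteqP; split => [_ ->|x [Tx]] /=.
  by split; [exact: simplex_of_vertex|rewrite E bary_vertex // eqxx].
rewrite E => /addIr xi.
rewrite -(bary_point v_indep x) (bigD1 i) //= xi scale1r big1 ?addr0 // => j ji.
suff /psumr_eq0P xj : \sum_(j | j != i) bary v x j = 0 by rewrite xj ?scale0r.
have := bary_sum v_indep x; rewrite (bigD1 i) //= xi.
by rewrite -[RHS]addr0 => /addrI.
Qed.

(** The matrix of barycentric coordinates of independent points has full rank, and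
    [s] of its columns vanish. *)
Lemma indep_zero_bary (m s : nat) (p : 'I_m -> 'rV[R]_n) (J : 'I_s -> 'I_n.+1) :
  affinely_independent p -> injective J ->
  (forall i t, bary v (p i) (J t) = 0) -> (m + s <= n.+1)%N.
Proof.
move=> p_indep J_inj p0.
pose P : 'M[R]_(m, n.+1) := \matrix_(i, l) bary v (p i) l.
pose D : 'M[R]_(n.+1, s) := \matrix_(l, t) (l == J t)%:R.
have PD : P *m D = 0.
  apply/matrixP => i t; rewrite !mxE (bigD1 (J t)) //= !mxE p0 mul0r add0r.
  by apply: big1 => l /negPf lJ; rewrite !mxE lJ mulr0.
have rP : \rank P = m.
  apply/eqP; rewrite -/(row_free P) -kermx_eq0; apply/eqP/row_matrixP => r.
  rewrite row0; have : row r (kermx P) *m P = 0 by rewrite -row_mul mulmx_ker row0.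
  move: (row r _) => w /rowP wP; apply/rowP => i; rewrite mxE; move: i.
  have wl l : \sum_i w 0 i * bary v (p i) l = 0.
    have := wP l; rewrite mxE [RHS]mxE => wPl.
    by rewrite -[RHS]wPl; apply: eq_bigr => i _; rewrite mxE.
  apply: (p_indep (fun i => w 0 i)).
    transitivity (\sum_i \sum_l w 0 i * bary v (p i) l).
      by apply: eq_bigr => i _; rewrite -mulr_sumr bary_sum // mulr1.
    by rewrite exchange_big big1 // => l _; exact: wl.
  transitivity (\sum_i \sum_l (w 0 i * bary v (p i) l) *: v l).
    apply: eq_bigr => i _; rewrite -{1}(bary_point v_indep (p i)) scaler_sumr.
    by apply: eq_bigr => l _; rewrite scalerA.
  rewrite exchange_big big1 // => l _; by rewrite -scaler_suml wl scale0r.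
have rD : \rank D = s.
  rewrite -mxrank_tr; apply/eqP; rewrite -/(row_free D^T); apply/row_freeP.
  exists D; apply/matrixP => t t'; rewrite !mxE (bigD1 (J t)) //= !mxE eqxx mul1r.
  rewrite (inj_eq J_inj) big1 ?addr0 // => l /negPf lJ.
  by rewrite !mxE lJ mul0r.
by have := mulmx0_rank_max PD; rewrite rP rD.
Qed.

End SimplexFaces.

Section SimplexFacets.
Context {R : realType} (k : nat) (v : 'I_k.+2 -> 'rV[R]_k.+1).
Hypothesis v_indep : affinely_independent v.
Notation T := (simplex_of v).

Lemma facet_of_face j : face T (facet_of v j).
Proof.
exists (- grad v j), (bary v 0 j).
have E x : dotv (- grad v j) x = bary v 0 j - bary v x j.
  by rewrite dotvNl [bary v x j]baryE; ring.
split=> [x Tx|]; first by rewrite E gerBl Tx.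
apply/seteqP; split => x [Tx xj]; split => //.
  by rewrite E xj subr0.
by move: xj; rewrite E -[RHS]addr0 => /addrI/eqP; rewrite oppr_eq0 => /eqP.
Qed.

Lemma facet_vertices_indep j : affinely_independent (fun i => v (lift j i)).
Proof.
move=> a a0 av.
pose b l := if unlift j l is Some i then a i else 0.
have bj : b j = 0 by rewrite /b unlift_none.
have bl i : b (lift j i) = a i by rewrite /b liftK.
have b0 : forall l, b l = 0.
  apply: v_indep.
    by rewrite (bigD1_ord j) //= bj add0r -[RHS]a0; apply: eq_bigr => i _; rewrite bl.
  rewrite (bigD1_ord j) //= bj scale0r add0r -[RHS]av.
  by apply: eq_bigr => i _; rewrite bl.
by move=> i; rewrite -bl b0.
Qed.

Lemma facet_of_affdim j : has_affdim (facet_of v j) k.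
Proof.
split.
  exists (fun i => v (lift j i)); split; last exact: facet_vertices_indep.
  move=> _ [i _ <-]; split; first exact: simplex_of_vertex.
  by rewrite bary_vertex // eq_sym (negPf (neq_lift _ _)).
move=> p pF p_indep.
suff : (k.+2 + 1 <= k.+2)%N by rewrite addn1 ltnn.
apply: (indep_zero_bary v_indep (J := fun _ : 'I_1 => j) p_indep).
  by move=> t t' _; rewrite (ord1 t) (ord1 t').
by move=> i _; have [] := pF (p i) (ex_intro2 _ _ i I erefl).
Qed.

Lemma facet_of_inj : injective (facet_of v).
Proof.
move=> i j ij; apply/eqP; apply: contraT => neq_ij.
have : facet_of v i (v j).
  by split; [exact: simplex_of_vertex|rewrite bary_vertex // eq_sym (negPf neq_ij)].
rewrite ij => -[_]; rewrite bary_vertex // eqxx => /eqP.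
by rewrite oner_eq0.
Qed.

(** A supporting functional has a slack at each vertex, and its face is where every
    vertex with positive slack has coordinate 0.  If no vertex had positive slack
    the face would be all of [T]; if two had, its dimension would be too small. *)
Lemma facets_simplex : facets T = range (facet_of v).
Proof.
apply/seteqP; split => [F [[u [b [uT FE]]] [[p [pF p_indep]] noF]]|_ [j _ <-]]; last first.
  by split; [exact: facet_of_face|exact: facet_of_affdim].
pose s i := b - dotv u (v i).
have s0 i : 0 <= s i by rewrite subr_ge0 uT //; exact: simplex_of_vertex.
have sE x : b - dotv u x = \sum_i bary v x i * s i.
  under eq_bigr do rewrite mulrBr.
  rewrite sumrB -mulr_suml bary_sum // mul1r -{1}(bary_point v_indep x) dotv_sumr.
  by congr (_ - _); apply: eq_bigr => i _; rewrite dotvZr.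
have Fz x i : F x -> 0 < s i -> bary v x i = 0.
  rewrite FE /= => -[Tx ux] si; have := sE x; rewrite ux subrr => /esym.
  move=> /psumr_eq0P xs; have /eqP := xs (fun i _ => mulr_ge0 (Tx i) (s0 i)) i isT.
  by rewrite mulf_eq0 (gt_eqF si) orbF => /eqP.
have [j sj] : exists j, 0 < s j.
  apply/existsP; apply: contraT => /existsPn ns.
  case: ((noF v)^~ v_indep) => _ [i _ <-]; rewrite FE; split; first exact: simplex_of_vertex.
  apply/eqP; rewrite eq_sym -subr_eq0 eq_le s0 andbT leNgt; exact: ns.
have s_uniq i : i != j -> s i = 0.
  move=> ij; apply/eqP; apply: contraT => si.
  have {}si : 0 < s i by rewrite lt_def si s0.
  suff : (k.+1 + 2 <= k.+2)%N by rewrite addn2 ltnn.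
  apply: (indep_zero_bary v_indep (J := fun t : 'I_2 => if t == 0 then i else j) p_indep).
    move=> t t'; rewrite -!val_eqE; case: t t' => [[|[|]]// ?] [[|[|]]// ?] /=.
    - by move=> _; exact/val_inj.
    - by move=> ijE; rewrite ijE eqxx in ij.
    - by move=> ijE; rewrite ijE eqxx in ij.
    - by move=> _; exact/val_inj.
  by move=> l t; have Fpl : F (p l) by [apply: pF; exists l]; case: ifP => _; exact: Fz.
exists j => //; apply/seteqP; split => x.
  by move=> [Tx xj]; rewrite FE; split => //; apply/eqP; rewrite eq_sym -subr_eq0 sE
    big1 // => i _; have [->|/s_uniq ->] := eqVneq i j; rewrite ?xj ?mul0r ?mulr0.
by move=> Fx; split; [move: Fx; rewrite FE => -[]|exact: Fz].
Qed.

Lemma sum_facets (G : set 'rV[R]_k.+1 -> R) :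
  \sum_(F \in facets T) G F = \sum_j G (facet_of v j).
Proof.
rewrite facets_simplex fsbig_image; last by move=> i j _ _; exact: facet_of_inj.
rewrite (fsbigE (enum 'I_k.+2)) ?enum_uniq // => [|i _]; last by rewrite mem_enum.
by rewrite big_enum_cond; apply: eq_bigl => i; rewrite in_setT.
Qed.

End SimplexFacets.

(** * Distances and the insphere *)

Section SimplexMetric.
Context {R : realType} (k : nat) (v : 'I_k.+2 -> 'rV[R]_k.+1).
Hypothesis v_indep : affinely_independent v.
Notation T := (simplex_of v).
Notation g := (grad v).

Lemma grad_norm_gt0 j : 0 < enorm (g j).
Proof. by rewrite enorm_gt0 grad_neq0. Qed.

Lemma bary_shift x y j : bary v (x + y) j = bary v x j + dotv (g j) y.
Proof. by rewrite baryE dotvDr addrA -baryE. Qed.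

(** From a point [q] with positive coordinates on the facet, a small step towards
    any point [y] of the hyperplane stays in the facet, so [y] lies on a line
    through two points of the facet. *)
Lemma affine_hull_facet j : affine_hull (facet_of v j) = [set y | bary v y j = 0].
Proof.
apply/seteqP; split.
  apply: smallest_sub; last by move=> x [].
  by move=> x y t /= xj yj; rewrite bary_comb // xj yj !mulr0 addr0.
move=> y /= yj A [affA FA].
(* The point [q] is the barycentre of the facet; the step [e] is chosen so that
   the coordinates of [z] stay nonnegative when those of [y] are at least [- B]. *)
have [m m0 mE] : exists2 m : R, 0 < m & m = k.+1%:R by exists k.+1%:R; rewrite ?ltr0n.
pose a l : R := if l == j then 0 else m^-1.
pose q := \sum_l a l *: v l.
have a1 : \sum_l a l = 1.
  rewrite (bigD1_ord j) //= /a eqxx add0r.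
  under eq_bigr do rewrite eq_sym (negPf (neq_lift _ _)).
  by rewrite big_const_ord iter_addr_0 -mulr_natr -mE mulVf // gt_eqF.
have qE l : bary v q l = a l by rewrite (bary_unique v_indep a1).
pose B := \sum_l `|bary v y l|.
have B0 : 0 <= B by apply: sumr_ge0.
have yB l : - B <= bary v y l.
  rewrite lerNl (le_trans (ler_norm _)) // normrN /B (bigD1 l) //= lerDl.
  by apply: sumr_ge0.
pose e := (1 + m * B)^-1.
have d0 : 0 < 1 + m * B by rewrite ltr_pwDl // mulr_ge0 // ltW.
have e0 : 0 < e by rewrite invr_gt0.
pose z := e *: y + (1 - e) *: q.
have ed : e * (1 + m * B) = 1 by rewrite mulVf // gt_eqF.
have eE : 1 - e = e * (m * B) by rewrite -{1}ed; ring.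
have zF : facet_of v j z.
  split=> [l|]; rewrite bary_comb // qE /a; last by rewrite yj eqxx !mulr0 addr0.
  case: eqVneq => [->|_]; first by rewrite yj !mulr0 addr0.
  have -> : e * bary v y l + (1 - e) * m^-1 = e * (bary v y l + B).
    by rewrite eE; field; rewrite gt_eqF.
  by apply: mulr_ge0; [exact: ltW|have := yB l; lra].
have qF : facet_of v j q.
  split=> [l|]; rewrite qE /a ?eqxx //.
  by case: ifP => // _; rewrite invr_ge0 ltW.
have -> : y = e^-1 *: z + (1 - e^-1) *: q.
  rewrite /z scalerDr !scalerA mulVf ?gt_eqF // scale1r -addrA -scalerDl.
  have -> : e^-1 * (1 - e) + (1 - e^-1) = 0.
    by rewrite mulrBr mulr1 mulVf ?gt_eqF //; ring.
  by rewrite scale0r addr0.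
exact: affA (FA _ zF) (FA _ qF).
Qed.

(** The minimum is attained at the foot of the perpendicular, along [g j]. *)
Lemma set_dist_facet x j :
  set_dist x (affine_hull (facet_of v j)) = `|bary v x j| / enorm (g j).
Proof.
have g0 := grad_norm_gt0 j.
rewrite affine_hull_facet /set_dist; set S := [set _ | _ in _].
have Slb : lbound S (`|bary v x j| / enorm (g j)).
  move=> _ [y /= yj <-]; rewrite ler_pdivrMr // mulrC.
  have -> : bary v x j = dotv (g j) (x - y).
    by rewrite -{1}(subrK y x) addrC bary_shift yj add0r.
  rewrite ler_norml dotv_le_enorm andbT lerNl -dotvNr.
  by rewrite (le_trans (dotv_le_enorm _ _)) // enormN.
have Sm : S (`|bary v x j| / enorm (g j)).
  exists (x - (bary v x j / enorm (g j) ^+ 2) *: g j) => /=.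
    rewrite bary_shift dotvNr dotvZr -enorm_sqr mulfVK ?subrr //.
    by rewrite expf_neq0 // gt_eqF.
  rewrite opprB addrC subrK enormZ normrM normfV [X in _ / X * _]ger0_norm ?sqr_ge0 //.
  by field; rewrite gt_eqF.
apply/eqP; rewrite eq_le; apply/andP; split.
  by apply: ge_inf => //; exists (`|bary v x j| / enorm (g j)).
by apply: lb_le_inf => //; exists (`|bary v x j| / enorm (g j)).
Qed.

(** The inverse of the inradius. *)
Definition gradsum : R := \sum_j enorm (g j).

Lemma gradsum_gt0 : 0 < gradsum.
Proof.
rewrite /gradsum big_ord_recl ltr_pwDl ?grad_norm_gt0 //.
by apply: sumr_ge0 => i _; exact: enorm_ge0.
Qed.

Lemma ball_in_simplex x r :
  (forall j, r * enorm (g j) <= bary v x j) ->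
  [set y | enorm (y - x) <= r] `<=` T.
Proof.
move=> xr y /= yx j; rewrite -(subrK x y) addrC bary_shift.
have := dotv_le_enorm (g j) (- (y - x)); rewrite dotvNr enormN => h.
have : enorm (g j) * enorm (y - x) <= r * enorm (g j).
  by rewrite [leRHS]mulrC ler_wpM2l ?enorm_ge0.
by have := xr j; lra.
Qed.

(** The point of the ball farthest in the direction [- g j] lies in the simplex,
    and the tangency point shows that it is on the facet. *)
Lemma insphere_bary x r : insphere T x r ->
  forall j, bary v x j = r * enorm (g j).
Proof.
move=> [r0 ballT tang] j; have g0 := grad_norm_gt0 j.
apply/eqP; rewrite eq_le; apply/andP; split.
  have Fj : facets T (facet_of v j) by rewrite facets_simplex //; exists j.
  have [y [_ yj] <-] := tang _ Fj.
  have -> : bary v x j = dotv (g j) (- (y - x)).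
    by rewrite opprB -{1}(subrK y x) addrC bary_shift yj add0r.
  by rewrite (le_trans (dotv_le_enorm _ _)) // enormN mulrC.
have : T (x - (r / enorm (g j)) *: g j).
  by apply: ballT => /=; rewrite addrAC subrr add0r enormN enorm_div // ltW.
move=> /(_ j); rewrite bary_shift dotvNr dotvZr -enorm_sqr.
rewrite (_ : _ / _ * _ = r * enorm (g j)) ?subr_ge0 //.
by field; rewrite gt_eqF.
Qed.

(** Weights proportional to the gradient norms, that is to the facet volumes,
    give the incenter. *)
Lemma insphere_exists : exists c, insphere T c gradsum^-1.
Proof.
have S0 := gradsum_gt0.
pose a j := gradsum^-1 * enorm (g j).
have a1 : \sum_j a j = 1 by rewrite -mulr_sumr mulVf // gt_eqF.
pose c := \sum_j a j *: v j; exists c.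
have cE j : bary v c j = a j by rewrite (bary_unique v_indep a1).
have ballT : [set y | enorm (y - c) <= gradsum^-1] `<=` T.
  by apply: ball_in_simplex => j; rewrite cE.
split=> //; first by rewrite invr_gt0.
move=> F; rewrite facets_simplex // => -[j _ <-]; have g0 := grad_norm_gt0 j.
have E : enorm (c - (gradsum^-1 / enorm (g j)) *: g j - c) = gradsum^-1.
  by rewrite addrAC subrr add0r enormN enorm_div // invr_ge0 ltW.
exists (c - (gradsum^-1 / enorm (g j)) *: g j) => //.
split; first by apply: ballT; rewrite /= E.
rewrite bary_shift dotvNr dotvZr -enorm_sqr cE /a.
by field; rewrite !gt_eqF.
Qed.

(** Summing [bary v x j = r * enorm (g j)] over [j] determines the radius. *)
Lemma set_dist_incenter j :
  set_dist (incenter T) (affine_hull (facet_of v j)) = gradsum^-1.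
Proof.
have : [set c | exists r, insphere T c r] (incenter T).
  apply: getPex; have [c Tc] := insphere_exists.
  by exists c, gradsum^-1.
move=> [r Tr]; have cE := insphere_bary Tr.
have S0 := gradsum_gt0; have g0 := grad_norm_gt0 j.
have r0 : 0 < r by case: Tr.
have rE : r = gradsum^-1.
  have := bary_sum v_indep (incenter T); under eq_bigr do rewrite cE.
  rewrite -mulr_sumr => rS; apply: (mulIf (x := gradsum)); first by rewrite gt_eqF.
  by rewrite mulVf ?gt_eqF.
rewrite set_dist_facet cE ger0_norm ?mulr_ge0 ?ltW // mulfK ?gt_eqF //.
Qed.

Lemma interior_bary x j : T° x -> 0 < bary v x j.
Proof.
move=> Tx; have g0 := grad_norm_gt0 j.
have : \forall t \near (0 : R)^'+, T (x - t *: g j).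
  have : (fun t : R => x - t *: g j) t @[t --> (0 : R)^'+] --> x.
    apply: cvg_at_right_filter.
    have xE : x = x - (0 : R) *: g j by rewrite scale0r subr0.
    rewrite [X in _ --> X]xE.
    apply: cvgB; first exact: cvg_cst.
    by apply: cvgZr_tmp; exact: cvg_id.
  by move=> /(_ _ Tx).
move=> nT.
have [t [Tt t0]] := filter_ex (filterI nT (nbhs_right_gt (0 : R))).
have := Tt j; rewrite bary_shift dotvNr dotvZr -enorm_sqr.
have : 0 < t * enorm (g j) ^+ 2 by rewrite mulr_gt0 // exprn_gt0.
by lra.
Qed.

End SimplexMetric.

(** * Volume of the facets *)

Section OrthonormalCompletion.
Context {R : realType}.

(** A reflection exchanging [e] with the first basis vector has [e] as its
    first row; its other rows form an orthonormal basis of the hyperplane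
    orthogonal to [e]. *)
Lemma orthonormal_hyperplane_basis k (e : 'rV[R]_(1 + k)) : e *m e^T = 1%:M ->
  exists2 B : 'M[R]_(k, 1 + k), B *m B^T = 1%:M & e^T *m e + B^T *m B = 1%:M.
Proof.
move=> e1.
suff [H [HH H0]] : exists H : 'M[R]_(1 + k), H *m H^T = 1%:M /\ usubmx H = e.
  exists (dsubmx H).
    have := HH; rewrite -{1 2}[H]vsubmxK tr_col_mx mul_col_row => /(congr1 drsubmx).
    by rewrite block_mxKdr => ->; rewrite scalar_mx_block block_mxKdr.
  have := mulmx1C HH; rewrite -{1 2}[H]vsubmxK tr_col_mx mul_row_col H0.
  exact.
pose d : 'rV[R]_(1 + k) := row_mx 1%:M 0.
have d1 : d *m d^T = 1%:M by rewrite tr_row_mx mul_row_col trmx1 mulmx1 trmx0 mulmx0 addr0.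
have dd : dotv d d = 1 by rewrite dotvE d1 mxE eqxx.
have ee : dotv e e = 1 by rewrite dotvE e1 mxE eqxx.
have dE (M : 'M[R]_(1 + k)) : d *m M = usubmx M.
  by rewrite -[M]vsubmxK mul_row_col mul1mx mul0mx addr0 vsubmxK.
have [ed|ed] := eqVneq e d.
  by exists 1%:M; split; [rewrite trmx1 mulmx1|rewrite -dE mulmx1].
have [u uD] : exists u, u = e - d by exists (e - d).
have u0 : dotv u u != 0 by rewrite dotv_eq0 uD subr_eq0.
have uE : dotv u u = 2 - 2 * dotv d e.
  by rewrite uD !dotv_lin ee dd [dotv e d]dotvC; ring.
pose t := 2 / dotv u u.
have uuT : u *m u^T = (dotv u u)%:M by rewrite [LHS]mx11_scalar dotvE.
exists (1%:M - t *: (u^T *m u)); split.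
  have [P PE] : exists P, P = u^T *m u by exists (u^T *m u).
  have PT : P^T = P by rewrite PE trmx_mul trmxK.
  have PP : P *m P = dotv u u *: P.
    by rewrite {1 2}PE mulmxA -[u^T *m u *m u^T]mulmxA uuT mul_mx_scalar -scalemxAl PE.
  rewrite -PE linearB /= trmx1 [(_ *: _)^T]linearZ /= PT.
  rewrite mulmxBl mul1mx mulmxBr mulmx1 -scalemxAl -scalemxAr PP !scalerA.
  have -> : t * t * dotv u u = t + t by rewrite /t; field; exact: u0.
  by apply/matrixP => a b; rewrite !mxE; ring.
rewrite -dE mulmxBr mulmx1 -scalemxAr mulmxA.
have -> : d *m u^T = (dotv d u)%:M by rewrite [LHS]mx11_scalar dotvE.
rewrite mul_scalar_mx scalerA.
have -> : t * dotv d u = -1.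
  have -> : dotv d u = - (dotv u u / 2) by rewrite uE uD !dotv_lin dd; field.
  by rewrite /t; field; exact: u0.
by rewrite scaleN1r opprK uD addrC subrK.
Qed.

End OrthonormalCompletion.

Section FullSimplexVolume.
Context {R : realType} (k : nat) (z : 'I_k.+1 -> 'rV[R]_k).
Hypothesis z_indep : affinely_independent z.

Definition edge_mx : 'M[R]_k := \matrix_i (z (lift ord0 i) - z ord0).

Lemma lift0E (i : 'I_k) : lift ord0 i = rshift 1 i :> 'I_(1 + k).
Proof. exact/val_inj. Qed.

Lemma det_vertex_mx_edge : \det (vertex_mx z) = \det edge_mx.
Proof.
have -> : vertex_mx z = block_mx (1%:M : 'M[R]_1) 0 (const_mx 1) 1%:M *m
                  block_mx (1%:M : 'M[R]_1) (z ord0) 0 edge_mx.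
  rewrite mulmx_block !mulmx1 !mul1mx ?mul0mx ?mulmx0 !addr0.
  apply/matrixP => i l; have [i' ->|i' ->] := split_ordP (i : 'I_(1 + k));
    have [l' ->|l' ->] := split_ordP (l : 'I_(1 + k)).
  - by rewrite (ord1 l') vertex_mx0 block_mxEul mxE (ord1 i') eqxx.
  - rewrite vertex_mxS block_mxEur; congr (z _ _ _); rewrite (ord1 i'); exact/val_inj.
  - by rewrite (ord1 l') vertex_mx0 block_mxEdl mxE.
  rewrite vertex_mxS block_mxEdr !mxE big_ord1 !mxE mul1r.
  by rewrite -lift0E addrC subrK.
by rewrite det_mulmx det_lblock det_ublock !det1 !mul1r.
Qed.

(** The simplex is the image of the standard one under the affine map given by its
    edges at the vertex 0. *)
Lemma lebesgue_simplex_of :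
  lebesgue_rV (simplex_of z) = (`|\det (vertex_mx z)| / k`!%:R)%:E.
Proof.
have uE : edge_mx \in unitmx by rewrite unitmxE -det_vertex_mx_edge -unitmxE vertex_mx_unit.
rewrite det_vertex_mx_edge -(lebesgue_simplex (z ord0) uE); congr lebesgue_rV.
pose a (y : 'rV[R]_k) (i : 'I_k.+1) : R :=
  if unlift ord0 i is Some i' then y 0 i' else 1 - \sum_l y 0 l.
have a0 y : a y ord0 = 1 - \sum_l y 0 l by rewrite /a unlift_none.
have aS y i : a y (lift ord0 i) = y 0 i by rewrite /a liftK.
have a1 y : \sum_i a y i = 1.
  rewrite big_ord_recl; under eq_bigr do rewrite aS.
  rewrite a0.
  by rewrite subrK.
have az y : \sum_i a y i *: z i = y *m edge_mx + z ord0.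
  rewrite big_ord_recl; under eq_bigr do rewrite aS.
  rewrite a0.
  rewrite mulmx_sum_row; under [in RHS]eq_bigr do rewrite rowK scalerBr.
  by rewrite sumrB -scaler_suml scalerBl scale1r addrC -!addrA; congr (_ + _); rewrite addrC.
have aE y i : bary z (y *m edge_mx + z ord0) i = a y i.
  exact: (bary_unique z_indep (a1 y) (az y)).
apply/seteqP; split => x /=.
  move=> x0; pose y : 'rV[R]_k := \row_i bary z x (lift ord0 i).
  have yE : 1 - \sum_l y 0 l = bary z x ord0.
    rewrite -(bary_sum z_indep x) big_ord_recl.
    by under [X in _ - X]eq_bigr do rewrite mxE; rewrite addrK.
  exists y; first by split=> [i|]; rewrite ?mxE // -subr_ge0 yE.
  rewrite -az -{1}(bary_point z_indep x); apply: eq_bigr => i _; congr (_ *: _).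
  by have [i' ->|->] := unliftP ord0 i; rewrite ?aS ?mxE // a0 yE.
move=> [y [y0 y1] ->] i; rewrite aE.
by have [i' ->|->] := unliftP ord0 i; rewrite ?aS // a0 subr_ge0.
Qed.

End FullSimplexVolume.

Section FacetVolume.
Context {R : realType} (k : nat) (v : 'I_k.+2 -> 'rV[R]_k.+1) (j : 'I_k.+2).
Hypothesis v_indep : affinely_independent v.
Notation g := (grad v j).

Section Chart.
Variables (B : 'M[R]_(k, k.+1)) (c : 'rV[R]_k.+1).
Hypothesis BB : B *m B^T = 1%:M.
Hypothesis FB : facet_of v j `<=` range (fun z : 'rV[R]_k => z *m B + c).

Definition chart_vertex (i : 'I_k.+1) : 'rV[R]_k := (v (lift j i) - c) *m B^T.
Notation z := chart_vertex.

Lemma chart_vertexE i : z i *m B + c = v (lift j i).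
Proof.
have Fw : facet_of v j (v (lift j i)).
  split; first exact: simplex_of_vertex.
  by rewrite bary_vertex // eq_sym (negPf (neq_lift _ _)).
have [y _ yE] := FB Fw.
by rewrite /z -yE addrK -[y *m B *m _]mulmxA BB mulmx1.
Qed.

Lemma chart_comb (a : 'I_k.+1 -> R) : \sum_i a i *: v (lift j i) =
  (\sum_i a i *: z i) *m B + (\sum_i a i) *: c.
Proof.
rewrite mulmx_suml scaler_suml -big_split /=; apply: eq_bigr => i _.
by rewrite -scalemxAl -scalerDr chart_vertexE.
Qed.

Lemma chart_vertex_indep : affinely_independent z.
Proof.
move=> a a0 az; apply: (facet_vertices_indep v_indep (j := j)) => //.
by rewrite chart_comb az a0 mul0mx scale0r addr0.
Qed.

(** In a chart of the facet hyperplane the remaining barycentric coordinates become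
    those of the facet seen as a full-dimensional simplex. *)
Lemma bary_chart x : bary v (x *m B + c) j = 0 /\
  forall i, bary v (x *m B + c) (lift j i) = bary z x i.
Proof.
pose b l := if unlift j l is Some i then bary z x i else 0.
have bj : b j = 0 by rewrite /b unlift_none.
have bl i : b (lift j i) = bary z x i by rewrite /b liftK.
have bE : bary v (x *m B + c) =1 b.
  apply: bary_unique => //.
    rewrite (bigD1_ord j) //= bj add0r; under eq_bigr do rewrite bl.
    by rewrite bary_sum //; exact: chart_vertex_indep.
  rewrite (bigD1_ord j) //= bj scale0r add0r; under eq_bigr do rewrite bl.
  rewrite chart_comb bary_sum ?bary_point ?scale1r //; exact: chart_vertex_indep.
by split=> [|i]; rewrite bE.
Qed.

Lemma chart_preimage_facet : [set x | facet_of v j (x *m B + c)] = simplex_of z.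
Proof.
apply/seteqP; split => x /=; have [xj xl] := bary_chart x.
  by move=> [xT _] i; rewrite -xl.
move=> x0; split=> // l; have [i ->|->] := unliftP j l; last by rewrite xj.
by rewrite xl.
Qed.

Lemma chart_orth_grad : B *m g^T = 0.
Proof.
apply/colP => t; rewrite [RHS]mxE.
have [x1 _] := bary_chart (delta_mx 0 t); have [x0 _] := bary_chart 0.
move: x1; rewrite addrC bary_shift // -rowE.
move: x0; rewrite mul0mx add0r => ->; rewrite add0r => <-.
by rewrite dotvC dotvE -row_mul [RHS]mxE.
Qed.

(** Multiply [vertex_mx v] by the isometry that completes the chart with the unit normal
    [e].  The normal column of the product is [bary v (v l) j / |g|], which vanishes
    except in row [j]; expanding the determinant along it leaves the matrix of the
    facet in the chart. *)
Lemma det_chart_vertex :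
  `|\det (vertex_mx z)| = `|\det (vertex_mx v)| * enorm g.
Proof.
have g0 : 0 < enorm g by exact: grad_norm_gt0.
pose e := (enorm g)^-1 *: g.
have ee : e *m e^T = 1%:M.
  rewrite [LHS]mx11_scalar -dotvE /e dotvZl dotvZr -enorm_sqr.
  by congr _%:M; field; rewrite gt_eqF.
have Be : B *m e^T = 0 by rewrite /e linearZ /= -scalemxAr chart_orth_grad scaler0.
pose O : 'M[R]_(k.+1, 1 + k) := row_mx e^T B^T.
have OO : O^T *m O = 1%:M.
  rewrite tr_row_mx !trmxK mul_col_row ee BB Be.
  have -> : e *m B^T = 0 by rewrite -[LHS]trmxK trmx_mul trmxK Be trmx0.
  by rewrite -scalar_mx_block.
have detO : `|\det (O : 'M[R]_(k.+1))| = 1.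
  have := congr1 (fun M => `|\det M|) OO.
  rewrite (det_mulmx (O^T : 'M[R]_k.+1) (O : 'M[R]_k.+1)) det_tr det1 normrM normr1.
  move=> /eqP; rewrite -expr2 sqrp_eq1 //; by move/eqP.
(* The constant [h] makes the normal coordinate vanish on the facet. *)
pose h : 'M[R]_1 := (bary v 0 j / enorm g)%:M.
pose Q : 'M[R]_(1 + (1 + k)) :=
  block_mx (1%:M : 'M[R]_1) (row_mx h (- (c *m B^T))) 0 O.
pose X : 'M[R]_(1 + (1 + k)) := (vertex_mx v : 'M[R]_(1 + (1 + k))) *m Q.
have XE l : row l X =
    row_mx (1%:M : 'M[R]_1) (row_mx (h + v l *m e^T) ((v l - c) *m B^T)).
  rewrite row_mul rowK /homog mul_row_block mulmx1 mulmx0 addr0.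
  have -> : const_mx 1 = 1%:M :> 'M[R]_1 by apply/matrixP => p q; rewrite !mxE !ord1.
  by rewrite mul1mx mul_mx_row add_row_mx mulmxBl [_ - _]addrC.
have X0 l : X l (lshift _ 0) = 1.
  have /rowP/(_ (lshift _ 0)) := XE l; rewrite mxE => ->.
  by rewrite row_mxEl mxE eqxx.
have X1 l : X l (rshift 1 (lshift k 0)) = (l == j)%:R / enorm g.
  have /rowP/(_ (rshift 1 (lshift k 0))) := XE l; rewrite mxE => ->.
  rewrite row_mxEr row_mxEl !mxE eqxx mulr1n -(bary_vertex v_indep).
  rewrite [bary v (v l) j]baryE mulrDl; congr (_ + _).
  by rewrite dotvC /dotv mulr_suml; apply: eq_bigr => i _; rewrite !mxE [_^-1 * _]mulrC mulrA.
have X2 l t : X l (rshift 1 (rshift 1 t)) = ((v l - c) *m B^T) 0 t.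
  have /rowP/(_ (rshift 1 (rshift 1 t))) := XE l; rewrite mxE => ->.
  by rewrite !row_mxEr.
pose col1 : 'I_(1 + (1 + k)) := rshift 1 (lshift k 0).
have minorE : row' j (col' col1 X) = vertex_mx z.
  apply/matrixP => i t; rewrite [LHS]mxE [LHS]mxE.
  have [t' ->|t' ->] := split_ordP (t : 'I_(1 + k)).
    rewrite (ord1 t') vertex_mx0 -(X0 (lift j i)); congr (X _ _); exact/val_inj.
  rewrite vertex_mxS -X2; congr (X _ _); exact/val_inj.
have : `|\det X| = `|\det (vertex_mx v)|.
  rewrite (det_mulmx (vertex_mx v : 'M[R]_(1 + (1 + k))) Q) normrM.
  by rewrite (det_ublock (1%:M : 'M[R]_1) _ (O : 'M[R]_(1+k))) det1 mul1r detO mulr1.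
rewrite (expand_det_col X col1) (bigD1 j) //= big1 => [|l /negPf lj].
  rewrite addr0 X1 eqxx /cofactor minorE div1r 2!normrM normrX normrN1 expr1n mul1r.
  rewrite normfV [X in X^-1]gtr0_norm // => <-.
  by rewrite mulrC mulrA mulfV ?mul1r // gt_eqF.
by rewrite X1 lj !mul0r.
Qed.

End Chart.

Lemma facet_chart_exists : exists (B : 'M[R]_(k, k.+1)) (c : 'rV[R]_k.+1),
  B *m B^T = 1%:M /\ facet_of v j `<=` range (fun z : 'rV[R]_k => z *m B + c).
Proof.
have g0 : 0 < enorm g by exact: grad_norm_gt0.
pose e : 'rV[R]_(1 + k) := (enorm g)^-1 *: g.
have ee : e *m e^T = 1%:M.
  rewrite [LHS]mx11_scalar -dotvE /e dotvZl dotvZr -enorm_sqr.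
  by congr _%:M; field; rewrite gt_eqF.
have [B BB eB] := orthonormal_hyperplane_basis ee.
exists B, (v (lift j ord0)); split => // x [_ xj].
set w := v (lift j ord0).
have xw : (x - w) *m e^T = 0.
  rewrite [LHS]mx11_scalar -dotvE /e dotvZr dotvC.
  have := bary_shift v w (x - w) j; rewrite addrC subrK xj bary_vertex //.
  by rewrite eq_sym (negPf (neq_lift _ _)) add0r => <-; rewrite mulr0 raddf0.
exists ((x - w) *m B^T) => //.
have -> : (x - w) *m B^T *m B = x - w.
  rewrite -mulmxA -[RHS]mulmx1 -eB mulmxDr [(x - w) *m (e^T *m e)]mulmxA xw.
  by rewrite mul0mx add0r.
by rewrite subrK.
Qed.

(** All charts give the same value, so the supremum is over a singleton. *)
Lemma kvol_facet : kvol k (facet_of v j) = `|\det (vertex_mx v)| * enorm g / k`!%:R.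
Proof.
rewrite /kvol (_ : [set _ | _] = [set (`|\det (vertex_mx v)| * enorm g / k`!%:R)%:E]).
  by rewrite ereal_sup1.
apply/seteqP; split => [_ [B [c [BB FB ->]]]|_ ->] /=.
  rewrite (chart_preimage_facet BB FB) lebesgue_simplex_of ?det_chart_vertex //.
  exact: chart_vertex_indep.
have [B [c [BB FB]]] := facet_chart_exists.
exists B, c; split => //.
rewrite (chart_preimage_facet BB FB) lebesgue_simplex_of ?det_chart_vertex //.
exact: chart_vertex_indep.
Qed.

End FacetVolume.

(** * Determinant and power-mean inequalities *)

Lemma exists_third n (p q : 'I_n.+1) : (1 < n)%N ->
  exists2 i : 'I_n.+1, i != p & i != q.
Proof.
move=> n1; have : (0 < #|~: [set p; q]|)%N.
  by rewrite cardsCs finset.setCK cards2 card_ord subn_gt0 ltnS (leq_ltn_trans (leq_b1 _)).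
by case/card_gt0P => i; rewrite !inE negb_or => /andP[]; exists i.
Qed.

Section Hadamard.
Context {R : realType}.

Definition posdef n (S : 'M[R]_n) : Prop :=
  S^T = S /\ forall x : 'rV[R]_n, x != 0 -> 0 < (x *m S *m x^T) 0 0.

Lemma posdef1 n : posdef (1%:M : 'M[R]_n).
Proof.
split=> [|x x0]; first exact: trmx1.
by rewrite mulmx1 -dotvE lt_def dotv_eq0 x0 dotv_ge0.
Qed.

Lemma posdef_congr m n (X : 'M[R]_(m, n)) (S : 'M[R]_n) :
  row_free X -> posdef S -> posdef (X *m S *m X^T).
Proof.
move=> fX [ST S0]; split=> [|x x0]; first by rewrite !trmx_mul trmxK ST mulmxA.
have xX0 : x *m X != 0.
  by apply: contra_neq x0 => xX; apply: (row_free_inj fX); rewrite xX mul0mx.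
by have := S0 _ xX0; rewrite trmx_mul !mulmxA.
Qed.

Lemma posdef_form_ge0 n (S : 'M[R]_n) (x : 'rV[R]_n) : posdef S -> 0 <= (x *m S *m x^T) 0 0.
Proof.
move=> [_ S0]; have [->|/S0/ltW//] := eqVneq x 0.
by rewrite !mul0mx mxE.
Qed.

Lemma posdef_diag_gt0 n (S : 'M[R]_n) i : posdef S -> 0 < S i i.
Proof.
move=> [_ /(_ (delta_mx 0 i))]; rewrite trmx_delta -rowE -colE !mxE; apply.
by apply/eqP => /rowP/(_ i); rewrite !mxE !eqxx => /eqP; rewrite oner_eq0.
Qed.

Lemma posdef_minor n (S : 'M[R]_n.+1) i : posdef S -> posdef (row' i (col' i S)).
Proof.
move=> pS; pose X : 'M[R]_(n, n.+1) := \matrix_(a, b) (b == lift i a)%:R.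
have XM (p : nat) (A : 'M[R]_(n.+1, p)) : X *m A = row' i A.
  apply/matrixP => a b; rewrite !mxE (bigD1 (lift i a)) //= mxE eqxx mul1r.
  by rewrite big1 ?addr0 // => l /negPf la; rewrite mxE la mul0r.
have -> : row' i (col' i S) = X *m S *m X^T.
  rewrite XM -[RHS]trmxK trmx_mul trmxK XM.
  by apply/matrixP => a b; rewrite !mxE.
apply: posdef_congr => //; apply/row_freeP; exists X^T.
rewrite XM; apply/matrixP => a b; rewrite !mxE.
by rewrite (inj_eq (lift_inj (h:=i))) .
Qed.

(** Hadamard's inequality.  With [al] the first diagonal entry, [D] the
    complementary block and [y D] the rest of the first row, the determinant is
    [(al - q) det D] where [q = y D y^T >= 0] is the drop to the Schur complement;
    equality forces [q = 0], hence [y = 0], at every stage. *)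
Lemma hadamard n (S : 'M[R]_n) : posdef S ->
  [/\ 0 < \det S, \det S <= \prod_i S i i &
      \det S = \prod_i S i i -> forall i j, i != j -> S i j = 0].
Proof.
elim: n S => [|n IH] S pS.
  by split; rewrite ?det_mx00 ?big_ord0 // => _ [].
pose S' : 'M[R]_(1 + n) := S.
pose b := ursubmx S'; pose D := drsubmx S'; pose al : R := S' 0 0.
have [ST S0] := pS.
have S0' : forall x : 'rV[R]_(1 + n), x != 0 -> 0 < (x *m S' *m x^T) 0 0 := S0.
have ulE : ulsubmx S' = al%:M.
  rewrite [LHS]mx11_scalar; congr _%:M; rewrite !mxE; congr (S' _ _); exact/val_inj.
have dlE : dlsubmx S' = b^T by rewrite /b trmx_ursub ST.
have DE : D = row' ord0 (col' ord0 S).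
  by apply/matrixP => i j; rewrite !mxE; congr (S _ _); exact/val_inj.
have pD : posdef D by rewrite DE; exact: posdef_minor.
have [D0 Dle Deq] := IH _ pD.
have [DT _] := pD.
have uD : D \in unitmx by rewrite unitmxE unitfE gt_eqF.
have [y yD] : exists y : 'rV[R]_n, y *m D = b by exists (b *m invmx D); rewrite mulmxKV.
pose q : R := (y *m D *m y^T) 0 0.
have qE : y *m D *m y^T = q%:M by rewrite [LHS]mx11_scalar.
have q0 : 0 <= q by exact: posdef_form_ge0.
have SE : S' = block_mx al%:M b b^T D by rewrite -[LHS]submxK ulE dlE.
have bT : b^T = D *m y^T by rewrite -yD trmx_mul DT.
pose U : 'M[R]_(1 + n) := block_mx (1%:M : 'M[R]_1) y 0 1%:M.
have SU : S' = U *m block_mx ((al - q)%:M : 'M[R]_1) 0 b^T D.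
  rewrite SE mulmx_block !mul1mx !mul0mx !add0r yD; congr block_mx.
  by rewrite bT mulmxA qE -raddfD subrK.
have detS : \det S = (al - q) * \det D.
  by rewrite -[S]/S' SU (det_mulmx U) /U det_ublock det_lblock !det1 !mul1r det_scalar1.
have alq : 0 < al - q.
  have : (row_mx (1%:M : 'M[R]_1) (- y) : 'rV[R]_(1 + n)) != 0.
    apply/eqP => /rowP/(_ (lshift n 0)); rewrite row_mxEl !mxE eqxx => /eqP.
    by rewrite oner_eq0.
  move=> /S0'; rewrite SE mul_row_block tr_row_mx mul_row_col trmx1 !mulNmx.
  rewrite yD !mul1mx subrr mul0mx addr0 mulmx1 bT mulmxA qE.
  by rewrite -raddfB mxE eqxx mulr1n.
have prodE : \prod_i S i i = al * \prod_i D i i.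
  rewrite big_ord_recl; congr (_ * _).
  by apply: eq_bigr => i _; rewrite DE !mxE.
have Dp : 0 < \prod_i D i i by exact: lt_le_trans Dle.
have al_ge : al - q <= al by rewrite gerBl.
rewrite prodE detS; split.
- by rewrite mulr_gt0.
- by rewrite ler_pM // ltW.
move=> eqn.
have detD : \det D = \prod_i D i i.
  apply/eqP; rewrite eq_le Dle /=; rewrite -(ler_pM2l alq) eqn.
  by rewrite ler_wpM2r // ltW.
have qq : q = 0.
  move: eqn; rewrite detD => /(mulIf (lt0r_neq0 Dp)) h; lra.
have y0 : y = 0.
  apply/eqP; apply: contraT => /(pD.2); rewrite -/q qq ltxx //.
have b0 : b = 0 by rewrite -yD y0 mul0mx.
have SE' (i j : 'I_(1 + n)) : S i j = block_mx (al%:M : 'M[R]_1) b b^T D i j by rewrite -SE.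
move=> i j; have [i' ->|i' ->] := split_ordP (i : 'I_(1 + n));
  have [j' ->|j' ->] := split_ordP (j : 'I_(1 + n)) => ij; rewrite SE'.
- by rewrite (ord1 i') (ord1 j') eqxx in ij.
- by rewrite block_mxEur b0 mxE.
- by rewrite block_mxEdl b0 !mxE.
- by rewrite block_mxEdr; apply: Deq.
Qed.


Lemma prod_le_mean n (E : 'I_n.+1 -> R) : (forall i, 0 <= E i) ->
  \prod_i E i <= ((\sum_i E i) / n.+1%:R) ^+ n.+1 /\
  (\prod_i E i = ((\sum_i E i) / n.+1%:R) ^+ n.+1 -> forall i j, E i = E j).
Proof.
move=> E0.
have := leif_AGM (A := 'I_n.+1) (E := E); rewrite card_ord => /(_ _)[//|le eqv].
split=> // /eqP; rewrite eqv => /forallP h i j.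
by have /implyP/(_ isT)/forallP/(_ j)/implyP/(_ isT)/eqP := h i.
Qed.

(** Maclaurin's inequality between the elementary symmetric functions of
    degrees [n] and [1] of [n + 1] positive numbers.  Singling out one
    variable [z] and writing [y] for the mean of the others, the induction step
    is the arithmetic-geometric mean inequality for [n] copies of [y] and one
    copy of [(y + (n + 1) z) / (n + 2)]. *)
Lemma maclaurin n (x : 'I_n.+1 -> R) : (forall i, 0 < x i) ->
  \sum_i \prod_l x (lift i l) <= n.+1%:R * ((\sum_i x i) / n.+1%:R) ^+ n /\
  ((1 < n)%N ->
   \sum_i \prod_l x (lift i l) = n.+1%:R * ((\sum_i x i) / n.+1%:R) ^+ n ->
   forall i j, x i = x j).
Proof.
elim: n x => [|n IH] x x0.
  by rewrite big_ord1 big_ord0 expr0 mulr1.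
pose x' i := x (lift ord0 i).
have x'0 i : 0 < x' i by exact: x0.
have [IHle _] := IH _ x'0.
have [Ple Peq] := prod_le_mean (fun i => ltW (x'0 i)).
pose N : R := n.+1%:R.
have N0 : 0 < N by rewrite ltr0n.
have Nn : n%:R = N - 1 :> R by rewrite /N -natr1 addrK.
have N2 : n.+2%:R = N + 1 :> R by rewrite /N -natr1.
rewrite N2.
pose y := (\sum_i x' i) / N.
pose z := x ord0.
have z0 : 0 < z by exact: x0.
have y0 : 0 < y.
  rewrite divr_gt0 // big_ord_recl ltr_pwDl //.
  by apply: sumr_ge0 => i _; rewrite ltW.
have sumE : (\sum_i x i) / (N + 1) = (z + N * y) / (N + 1).
  by rewrite big_ord_recl; congr ((_ + _) / _); rewrite /y mulrC divfK // gt_eqF.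
have symE : \sum_i \prod_l x (lift i l) =
    \prod_i x' i + z * \sum_i \prod_l x' (lift i l).
  rewrite big_ord_recl; congr (_ + _); rewrite mulr_sumr; apply: eq_bigr => i _.
  rewrite big_ord_recl; congr (x _ * _); first exact/val_inj.
  apply: eq_bigr => l _; congr (x _); apply/val_inj => /=.
  by rewrite /bump leq_add2l addnCA.
pose w := (y + N * z) / (N + 1).
have w0 : 0 < w by rewrite divr_gt0 // addr_gt0 // mulr_gt0.
pose F (i : 'I_n.+1) := if i == ord0 then w else y.
have F0 i : 0 <= F i by rewrite /F; case: ifP => _; exact: ltW.
have [Fle Feq] := prod_le_mean F0.
have prodF : \prod_i F i = w * y ^+ n.
  by rewrite big_ord_recl /F eqxx prodr_const card_ord.
have meanF : (\sum_i F i) / n.+1%:R = (z + N * y) / (N + 1).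
  rewrite big_ord_recl /F eqxx sumr_const card_ord -[y *+ _]mulr_natr Nn /w -/N.
  by field; rewrite !gt_eqF // addr_gt0.
rewrite prodF meanF in Fle Feq; rewrite sumE symE.
have bound : \prod_i x' i + z * \sum_i \prod_l x' (lift i l) <= (N + 1) * (w * y ^+ n).
  have -> : (N + 1) * (w * y ^+ n) = y ^+ n.+1 + z * (N * y ^+ n).
    by rewrite /w exprS; field; rewrite gt_eqF // addr_gt0.
  by rewrite lerD // ler_wpM2l // ltW.
have N1 : 0 < N + 1 by rewrite addr_gt0.
split; first by rewrite (le_trans bound) // ler_pM2l.
rewrite ltnS => n0 eqn.
have tight : w * y ^+ n = ((z + N * y) / (N + 1)) ^+ n.+1.
  by apply/eqP; rewrite eq_le Fle /= -(ler_pM2l N1) -eqn.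
have yw : w = y.
  have := Feq tight ord0 ord_max; rewrite /F eqxx -val_eqE /=.
  by case: (n) n0.
have yz : z = y.
  move: yw; rewrite /w => /(canRL (mulfVK (lt0r_neq0 N1))) h.
  by apply: (mulfI (lt0r_neq0 N0)); lra.
have Ptight : \prod_i x' i = y ^+ n.+1.
  apply/eqP; rewrite eq_le Ple /= -(lerD2r (z * \sum_i \prod_l x' (lift i l))) eqn -tight.
  have -> : (N + 1) * (w * y ^+ n) = y ^+ n.+1 + z * (N * y ^+ n).
    by rewrite /w exprS; field; rewrite gt_eqF.
  by rewrite lerD2l ler_wpM2l // ltW.
have x'eq := Peq Ptight.
have x'y i : x' i = y.
  rewrite /y; under eq_bigr => l _ do rewrite (x'eq l i).
  by rewrite sumr_const card_ord -[x' i *+ _]mulr_natr -/N mulfK // gt_eqF.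
have xy i : x i = y.
  by have [l ->|->] := unliftP ord0 i; [exact: x'y|exact: yz].
by move=> i j; rewrite !xy.
Qed.

(** The diagonal entries of the adjugate are principal minors, which Hadamard's
    inequality bounds by products of diagonal entries; Maclaurin's inequality
    bounds the sum of these products.  An off-diagonal entry of [S] occurs in some
    principal minor of codimension 1 only if [n >= 2]. *)
Lemma trace_adj_le n (S : 'M[R]_n.+1) : posdef S ->
  \tr (\adj S) <= n.+1%:R * (\tr S / n.+1%:R) ^+ n /\
  ((1 < n)%N -> \tr (\adj S) = n.+1%:R * (\tr S / n.+1%:R) ^+ n ->
   S = (\tr S / n.+1%:R)%:M).
Proof.
move=> pS.
have Sii i : 0 < S i i by exact: posdef_diag_gt0.
have adjE i : (\adj S) i i = \det (row' i (col' i S)).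
  by rewrite mxE /cofactor -signr_odd addnn odd_double expr0 mul1r.
have minE i : \prod_l row' i (col' i S) l l = \prod_l S (lift i l) (lift i l).
  by apply: eq_bigr => l _; rewrite !mxE.
have Hle i : (\adj S) i i <= \prod_l S (lift i l) (lift i l).
  by rewrite adjE -minE; have [] := hadamard (posdef_minor i pS).
have [Mle Meq] := maclaurin Sii.
rewrite -/(\tr S) in Mle Meq.
have sle : \tr (\adj S) <= \sum_i \prod_l S (lift i l) (lift i l).
  by apply: ler_sum => i _; exact: Hle.
split; first exact: le_trans Mle.
move=> n1 eqn.
have Mt : \sum_i \prod_l S (lift i l) (lift i l) = n.+1%:R * (\tr S / n.+1%:R) ^+ n.
  by apply/eqP; rewrite eq_le Mle /= -eqn.
have diag := Meq n1 Mt.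
have Ht i : (\adj S) i i = \prod_l S (lift i l) (lift i l).
  apply/eqP; rewrite -subr_eq0 -oppr_eq0 opprB.
  have /psumr_eq0P h : \sum_i (\prod_l S (lift i l) (lift i l) - (\adj S) i i) = 0.
    by rewrite sumrB Mt -eqn /mxtrace subrr.
  by rewrite h // => l _; rewrite subr_ge0.
have off (i : 'I_n.+1) (a b : 'I_n) : a != b -> S (lift i a) (lift i b) = 0.
  have [_ _ /(_ _ a b)] := hadamard (posdef_minor i pS).
  by rewrite -adjE minE => /(_ (Ht i)) h ab; rewrite -[RHS](h ab) !mxE.
apply/matrixP => p q; rewrite mxE.
have [->|pq] := eqVneq p q.
  rewrite mulr1n /mxtrace; under eq_bigr => l _ do rewrite (diag l q).
  by rewrite sumr_const card_ord -[S q q *+ _]mulr_natr mulfK // pnatr_eq0.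
rewrite mulr0n.
have [i ip iq] := exists_third p q n1.
have [a pE|pE] := unliftP i p; last by rewrite pE eqxx in ip.
have [b qE|qE] := unliftP i q; last by rewrite qE eqxx in iq.
by rewrite pE qE off //; apply: contra_neq pq => ab; rewrite pE qE ab.
Qed.

End Hadamard.

(** The difference of the two sides is [m + 1] times the sum of the squared
    deviations from the mean. *)
Lemma sqr_sum_le {R : realType} m (x : 'I_m.+1 -> R) :
  (\sum_i x i) ^+ 2 <= m.+1%:R * \sum_i x i ^+ 2 /\
  ((\sum_i x i) ^+ 2 = m.+1%:R * \sum_i x i ^+ 2 -> forall i j, x i = x j).
Proof.
have [N N0 NE] : exists2 N : R, 0 < N & N = m.+1%:R by exists m.+1%:R; rewrite ?ltr0n.
rewrite -NE; set X := \sum_i x i; set Y := \sum_i x i ^+ 2.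
have var : \sum_i (x i - X / N) ^+ 2 = Y - X ^+ 2 / N.
  transitivity (\sum_i (x i ^+ 2 - 2 * (X / N) * x i + (X / N) ^+ 2)).
    by apply: eq_bigr => i _; ring.
  rewrite big_split sumrB -mulr_sumr sumr_const card_ord -[(X / N) ^+ 2 *+ _]mulr_natr -NE -/X -/Y /=.
  by field; rewrite gt_eqF.
have sq0 i : 0 <= (x i - X / N) ^+ 2 by exact: sqr_ge0.
have le0 : 0 <= Y - X ^+ 2 / N by rewrite -var sumr_ge0.
have NY : N * Y - X ^+ 2 = N * (Y - X ^+ 2 / N) by field; rewrite gt_eqF.
split; first by rewrite -subr_ge0 NY mulr_ge0 // ltW.
move=> XY; have xm i : x i = X / N.
  apply/eqP; rewrite -subr_eq0 -sqrf_eq0; apply/eqP.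
  apply: (psumr_eq0P (fun i _ => sq0 i)) i isT.
  by rewrite var; apply: (mulfI (lt0r_neq0 N0)); rewrite -NY XY subrr mulr0.
by move=> i j; rewrite !xm.
Qed.

Section Jensen.
Context {R : realType} (phi : R -> R).
Hypothesis phi_concave : concave_function `]0, +oo[ phi.

Lemma concaveP (x y t : R) : 0 < x -> 0 < y -> 0 <= t -> t <= 1 ->
  t * phi x + (1 - t) * phi y <= phi (t * x + (1 - t) * y).
Proof.
move=> x0 y0 t0 t1.
have := phi_concave (Itv01 t0 t1) (x := x) (y := y).
rewrite !inE /= !in_itv /= !andbT => /(_ x0 y0).
rewrite convRE /= => h.
by move: h; rewrite /conv /= /unstable.onem /GRing.scale /=; lra.
Qed.

(** The induction step applies concavity to the first point and to the weighted
    mean of the others. *)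
Lemma jensen (m : nat) (w x : 'I_m.+1 -> R) :
  (forall i, 0 < w i) -> (forall i, 0 < x i) ->
  \sum_i w i * phi (x i) <=
  (\sum_i w i) * phi ((\sum_i w i * x i) / \sum_i w i).
Proof.
elim: m w x => [|m IH] w x w0 x0.
  rewrite !big_ord1 [w ord0 * x ord0]mulrC mulfK // gt_eqF //.
rewrite ![\sum_(i < m.+2) _]big_ord_recl.
have [w0' x0'] : (forall i, 0 < w (lift ord0 i)) /\ (forall i, 0 < x (lift ord0 i)) by [].
have := IH _ _ w0' x0'.
have pos (f : 'I_m.+1 -> R) : (forall i, 0 < f i) -> 0 < \sum_i f i.
  by move=> f0; rewrite big_ord_recl ltr_pwDl // sumr_ge0 // => i _; exact: ltW.
set W := \sum_i w _; set P := \sum_i w _ * phi _; set X := \sum_i w _ * x _ => h.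
have W0 : 0 < W by exact: pos.
have X0 : 0 < X by apply: pos => i; rewrite mulr_gt0.
have u0 := w0 ord0; have z0 := x0 ord0.
set u := w ord0 in u0 *; set z := x ord0 in z0 *.
have uW : 0 < u + W by rewrite addr_gt0.
have t0 : 0 <= u / (u + W) by rewrite divr_ge0 // ltW.
have t1 : u / (u + W) <= 1 by rewrite ler_pdivrMr // mul1r lerDl ltW.
have := concaveP z0 (divr_gt0 X0 W0) t0 t1.
have -> : u / (u + W) * z + (1 - u / (u + W)) * (X / W) = (u * z + X) / (u + W).
  by field; rewrite !gt_eqF.
rewrite -(ler_pM2l uW) => h'; apply: le_trans h'.
have -> : (u + W) * (u / (u + W) * phi z + (1 - u / (u + W)) * phi (X / W)) =
          u * phi z + W * phi (X / W) by field; rewrite gt_eqF.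
by rewrite lerD2l.
Qed.

End Jensen.

(** * Inradius and surface area of an inscribed simplex *)

Section AreaBound.
Context {R : realType} (k : nat) (v : 'I_k.+2 -> 'rV[R]_k.+1).
Hypothesis v_indep : affinely_independent v.
Hypothesis v_unit : forall i, enorm (v i) = 1.
Notation g := (grad v).
Notation a := (`|\det (vertex_mx v)|).
Notation s := (gradsum v).
Let n : R := k.+1%:R.
Let N : R := k.+2%:R.

Let n0 : 0 < n. Proof. exact: ltr0Sn. Qed.
Let N0 : 0 < N. Proof. exact: ltr0Sn. Qed.

Lemma dotv_unit i : dotv (v i) (v i) = 1.
Proof. by rewrite -enorm_sqr v_unit expr1n. Qed.

Lemma dotv_grad_vertex i j : dotv (g i) (v j) = (i == j)%:R - bary v 0 i.
Proof. by rewrite -(eq_sym j) -(bary_vertex v_indep) [bary v (v j) i]baryE addrC addKr. Qed.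

Lemma gradsum_ge : n <= s.
Proof.
rewrite /n -(grad_trace v_indep); apply: ler_sum => i _.
by rewrite (le_trans (dotv_le_enorm _ _)) // v_unit mulr1.
Qed.

(** Equality in Cauchy-Schwarz makes [g i] the multiple [|g i| v i]; then
    [<v i, v j> = 1 - 1 / |g i|] for all [j != i], and exchanging [i] and [j] shows
    that this value is the same for all pairs. *)
Lemma gradsum_eq : s = n -> exists l, forall i j, i != j -> enorm (v i - v j) = l.
Proof.
rewrite /n -(grad_trace v_indep) => sn.
have le i : dotv (g i) (v i) <= enorm (g i).
  by rewrite (le_trans (dotv_le_enorm _ _)) // v_unit mulr1.
have gv i : g i = enorm (g i) *: v i.
  have /psumr_eq0P h : \sum_i (enorm (g i) - dotv (g i) (v i)) = 0.
    by rewrite sumrB -/s sn subrr.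
  have := dotv_eq_enorm (u := g i) (v := v i); rewrite v_unit mulr1 scale1r; apply.
  by apply/eqP; rewrite eq_sym -subr_eq0 h // => l _; rewrite subr_ge0.
have vv i j : i != j -> dotv (v i) (v j) = 1 - (enorm (g i))^-1.
  move=> ij; have g0 := grad_norm_gt0 v_indep i.
  have E1 : enorm (g i) = 1 - bary v 0 i.
    by have := dotv_grad_vertex i i; rewrite {1}gv dotvZl dotv_unit mulr1 eqxx.
  have E2 : enorm (g i) * dotv (v i) (v j) = - bary v 0 i.
    by have := dotv_grad_vertex i j; rewrite {1}gv dotvZl (negPf ij) sub0r.
  apply: (mulfI (lt0r_neq0 g0)); rewrite E2 mulrBr mulr1 mulfV ?gt_eqF //; lra.
have G i : enorm (g i) = enorm (g ord0).
  have [->//|i0] := eqVneq i ord0.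
  have := vv _ _ i0; rewrite dotvC vv 1?eq_sym // => h.
  by apply: invr_inj; lra.
exists (Num.sqrt (2 * (enorm (g ord0))^-1)) => i j ij.
rewrite /enorm !dotv_lin !dotv_unit [dotv (v j) (v i)]dotvC vv // G.
by congr Num.sqrt; ring.
Qed.

Definition centroid : 'rV[R]_k.+1 := N^-1 *: \sum_i v i.
Definition centered : 'M[R]_(k.+2, k.+1) := \matrix_i (v i - centroid).
Definition scatter : 'M[R]_k.+1 := centered^T *m centered.
Definition grad_mx : 'M[R]_(k.+2, k.+1) := \matrix_i g i.

Lemma bary_centroid i : bary v centroid i = N^-1.
Proof.
apply: (bary_unique (a := fun=> N^-1) v_indep).
  by rewrite sumr_const card_ord -[_ *+ _]mulr_natr mulVf // gt_eqF // N0.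
by rewrite -scaler_sumr.
Qed.

Lemma centered_colsum : \sum_i (v i - centroid) = 0.
Proof.
by rewrite sumrB sumr_const card_ord -scaler_nat /centroid scalerA mulfV ?scale1r ?subrr.
Qed.

Lemma grad_centered : grad_mx^T *m centered = 1%:M.
Proof.
apply/row_matrixP => p; rewrite row1.
transitivity (\sum_i g i 0 p *: (v i - centroid)).
  apply/rowP => q; rewrite !mxE summxE; apply: eq_bigr => i _.
  by rewrite !mxE.
under eq_bigr do rewrite scalerBr.
rewrite sumrB -scaler_suml.
have -> : \sum_i g i 0 p = 0 by rewrite -summxE grad_sum // mxE.
rewrite scale0r subr0 -[RHS](grad_dual v_indep); apply: eq_bigr => i _; congr (_ *: _).
by rewrite dotvE trmx_delta -colE [RHS]mxE.
Qed.

(** The entry [<g i, v j - c>] is [bary v (v j) i - bary v c i]. *)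
Lemma grad_mul_centered : grad_mx *m centered^T = 1%:M - const_mx N^-1.
Proof.
apply/matrixP => i j; rewrite !mxE.
transitivity (dotv (g i) (v j - centroid)).
  by apply: eq_bigr => l _; rewrite !mxE.
have := bary_centroid i; rewrite baryE => cE.
by rewrite dotvBr dotv_grad_vertex -cE; ring.
Qed.

Lemma const_mul_centered (c : R) : (const_mx c : 'M[R]_k.+2) *m centered = 0.
Proof.
apply/matrixP => i j; rewrite !mxE.
have /rowP/(_ j) := centered_colsum; rewrite summxE [RHS]mxE => h.
transitivity (c * \sum_i (v i - centroid) 0 j); last by rewrite h mulr0.
by rewrite mulr_sumr; apply: eq_bigr => l _; rewrite !mxE.
Qed.

Lemma grad_mul_scatter : grad_mx *m scatter = centered.
Proof.
by rewrite /scatter mulmxA grad_mul_centered mulmxBl mul1mx const_mul_centered subr0.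
Qed.

(** The scatter matrix of the vertices and that of the gradients are inverse to each
    other, a matrix form of duality. *)
Lemma scatter_inv : (grad_mx^T *m grad_mx) *m scatter = 1%:M.
Proof. by rewrite -mulmxA grad_mul_scatter grad_centered. Qed.

Lemma scatter_posdef : posdef scatter.
Proof.
have fX : row_free centered^T.
  apply/row_freeP; exists grad_mx.
  by rewrite -[LHS]trmxK trmx_mul trmxK grad_centered trmx1.
by have := posdef_congr fX (posdef1 _); rewrite mulmx1 trmxK.
Qed.

Lemma sum_grad_sqr : \sum_i enorm (g i) ^+ 2 = \tr (grad_mx^T *m grad_mx).
Proof.
rewrite mxtrace_mulC; apply: eq_bigr => i _.
by rewrite enorm_sqr mxE; apply: eq_bigr => l _; rewrite !mxE.
Qed.

(** Translating the vertices to centroid 0 does not change the determinant of [vertex_mx]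
    and makes the columns of coordinates orthogonal to the column of ones. *)
Lemma det_scatter : a ^+ 2 = N * \det scatter.
Proof.
pose W : 'M[R]_(1 + k.+1) := row_mx (const_mx 1 : 'cV_k.+2) centered.
have vE : vertex_mx v = W *m block_mx (1%:M : 'M[R]_1) centroid 0 1%:M.
  rewrite mul_row_block mulmx1 mulmx0 addr0 mulmx1.
  apply/matrixP => i j; have [j' ->|j' ->] := split_ordP (j : 'I_(1 + k.+1)).
    by rewrite (ord1 j') vertex_mx0 row_mxEl mxE.
  by rewrite vertex_mxS row_mxEr !mxE big_ord1 !mxE mul1r addrC subrK.
have WW : W^T *m W = block_mx (N%:M : 'M[R]_1) 0 0 scatter.
  rewrite tr_row_mx mul_col_row -/scatter; congr block_mx.
  - apply/matrixP => i j; rewrite !mxE !ord1 eqxx mulr1n.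
    under eq_bigr do rewrite !mxE mulr1.
    by rewrite sumr_const card_ord.
  - apply/matrixP => i j; rewrite !mxE.
    have := const_mul_centered 1 => /matrixP/(_ ord0 j); rewrite !mxE => h.
    rewrite -[RHS]h; apply: eq_bigr => l _; by rewrite !mxE.
  - apply/matrixP => i j; rewrite !mxE.
    have := const_mul_centered 1 => /matrixP/(_ ord0 i); rewrite !mxE => h.
    by rewrite -[RHS]h; apply: eq_bigr => l _; rewrite !mxE mulrC.
rewrite -normrX ger0_norm ?sqr_ge0 // vE det_mulmx det_ublock !det1 !mulr1.
have := congr1 determinant WW; rewrite det_mulmx det_tr det_ublock det_scalar1 => <-.
by rewrite expr2.
Qed.

Lemma trace_scatter : \tr scatter = N * (1 - dotv centroid centroid).
Proof.
rewrite /scatter mxtrace_mulC.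
transitivity (\sum_i dotv (v i - centroid) (v i - centroid)).
  by apply: eq_bigr => i _; rewrite mxE; apply: eq_bigr => l _; rewrite !mxE.
have cE : \sum_i v i = N *: centroid.
  by rewrite /centroid scalerA mulfV ?scale1r // gt_eqF // N0.
transitivity (\sum_i (1 + dotv centroid centroid - 2 * dotv (v i) centroid)).
  by apply: eq_bigr => i _; rewrite dotvBl !dotvBr dotv_unit [dotv centroid (v i)]dotvC; ring.
rewrite sumrB sumr_const card_ord -mulr_sumr -dotv_suml cE dotvZl -[_ *+ _]mulr_natr -/N.
ring.
Qed.

Lemma grad_sqr_adj : a ^+ 2 * \sum_i enorm (g i) ^+ 2 = N * \tr (\adj scatter).
Proof.
rewrite det_scatter sum_grad_sqr -mulrA; congr (_ * _).
have -> : \adj scatter = \det scatter *: (grad_mx^T *m grad_mx).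
  by rewrite -[LHS]mul1mx -scatter_inv -(mulmxA (grad_mx^T *m grad_mx) scatter) mul_mx_adj
    mul_mx_scalar.
by rewrite mxtraceZ.
Qed.

(** The square of [k!] times the area of the inscribed regular simplex. *)
Definition max_area_sqr : R := N ^+ 2 * n * (N / n) ^+ k.

Lemma trace_scatter_gt0 : 0 < \tr scatter.
Proof.
rewrite /mxtrace big_ord_recl ltr_pwDl ?posdef_diag_gt0 //; try exact: scatter_posdef.
by apply: sumr_ge0 => i _; apply: ltW; apply: posdef_diag_gt0; exact: scatter_posdef.
Qed.

Lemma trace_scatter_le : \tr scatter <= N.
Proof.
rewrite trace_scatter ger_pMr ?N0 // lerBlDr lerDl.
exact: dotv_ge0.
Qed.

(** The steps of the area bound are kept apart because equality is traced back
    through each of them. *)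
Lemma area_chain :
  [/\ (a * s) ^+ 2 <= a ^+ 2 * (N * \sum_i enorm (g i) ^+ 2),
     a ^+ 2 * (N * \sum_i enorm (g i) ^+ 2) = N ^+ 2 * \tr (\adj scatter),
     N ^+ 2 * \tr (\adj scatter) <= N ^+ 2 * (n * (\tr scatter / n) ^+ k) &
     N ^+ 2 * (n * (\tr scatter / n) ^+ k) <= max_area_sqr].
Proof.
have N20 : 0 < N ^+ 2 by rewrite exprn_gt0.
split.
- rewrite exprMn ler_wpM2l ?sqr_ge0 //.
  by have [] := sqr_sum_le (fun i => enorm (g i)).
- by rewrite mulrCA grad_sqr_adj mulrA -expr2.
- rewrite ler_pM2l //.
  by have [] := trace_adj_le scatter_posdef.
rewrite /max_area_sqr -mulrA ler_pM2l // ler_pM2l //.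
have t0 := trace_scatter_gt0.
apply: lerXn2r; rewrite ?nnegrE; [exact: ltW (divr_gt0 _ _)|exact: ltW (divr_gt0 _ _)|].
by rewrite ler_pM2r ?invr_gt0 // trace_scatter_le.
Qed.

Lemma area_le : (a * s) ^+ 2 <= max_area_sqr.
Proof.
by have [h1 h2 h3 h4] := area_chain; rewrite (le_trans h1) // h2 (le_trans h3).
Qed.

Lemma vol_factor_gt0 : 0 < a.
Proof. by rewrite normr_gt0 -unitfE -unitmxE vertex_mx_unit. Qed.

Lemma area_eq_grad : (a * s) ^+ 2 = max_area_sqr ->
  forall i j, enorm (g i) = enorm (g j).
Proof.
move=> eqn; have [h1 h2 h3 h4] := area_chain.
have [_] := sqr_sum_le (fun i => enorm (g i)); apply.
apply: (mulfI (x := a ^+ 2)); first by rewrite expf_neq0 // gt_eqF // vol_factor_gt0.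
rewrite -exprMn; apply/eqP; rewrite eq_le h1 /= eqn h2.
exact: le_trans h4.
Qed.

Lemma area_eq_scatter : (1 < k)%N -> (a * s) ^+ 2 = max_area_sqr ->
  centroid = 0 /\ scatter = (N / n)%:M.
Proof.
move=> k1 eqn; have [h1 h2 h3 h4] := area_chain.
have N20 : 0 < N ^+ 2 by rewrite exprn_gt0.
have t0 := trace_scatter_gt0.
have e3 : \tr (\adj scatter) = n * (\tr scatter / n) ^+ k.
  apply: (mulfI (lt0r_neq0 N20)); apply/eqP; rewrite eq_le h3 /=.
  by rewrite (le_trans h4) // -eqn (le_trans h1) // h2.
have tN : \tr scatter = N.
  have e4 : (\tr scatter / n) ^+ k = (N / n) ^+ k.
    apply: (mulfI (lt0r_neq0 n0)); apply: (mulfI (lt0r_neq0 N20)).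
    apply/eqP; rewrite eq_le [X in _ <= X]mulrA h4 /= mulrA -/max_area_sqr -eqn.
    by rewrite (le_trans h1) // h2.
  have k0 : (0 < k)%N by exact: ltnW.
  move: e4 => /eqP; rewrite eqrXn2 ?divr_ge0 ?ltW // => /eqP.
  by move=> /(divIf (lt0r_neq0 n0)).
split.
  apply/eqP; rewrite -dotv_eq0; apply/eqP.
  have := trace_scatter; rewrite tN -{1}[N]mulr1 => /(mulfI (lt0r_neq0 N0)); lra.
have [_ /(_ k1 e3)] := trace_adj_le scatter_posdef.
by rewrite tN.
Qed.

(** With a scalar scatter matrix the dual systems of gradients and vertices are
    proportional. *)
Lemma scalar_scatter_equidistant : centroid = 0 -> scatter = (N / n)%:M ->
  forall i j, i != j -> enorm (v i - v j) = Num.sqrt (2 * (N / n)).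
Proof.
move=> c0 St.
have wE i : v i = (N / n) *: g i.
  have := grad_mul_scatter; rewrite St mul_mx_scalar => /row_matrixP/(_ i).
  by rewrite linearZ /= !rowK c0 subr0 => ->.
move=> i j ij; rewrite /enorm; congr Num.sqrt.
rewrite [in X in dotv X _](wE i) [in X in dotv X _](wE j) -scalerBr dotvZl dotvBl !dotvBr.
have := bary_centroid i; have := bary_centroid j; rewrite c0 => cj ci.
rewrite !dotv_grad_vertex !eqxx [j == i]eq_sym (negPf ij) ci cj.
by rewrite mulrC mulr1n mulr0n; congr (_ * _); ring.
Qed.

(** In the plane the facets are the edges. *)
Lemma edge_length_triangle (v' : 'I_3 -> 'rV[R]_2) (j : 'I_3) :
  affinely_independent v' ->
  enorm (v' (lift j ord0) - v' (lift j ord_max)) =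
  `|\det (vertex_mx v')| * enorm (grad v' j).
Proof.
move=> v'_indep; have [B [c [BB FB]]] := facet_chart_exists j v'_indep.
rewrite -(det_chart_vertex v'_indep BB FB) det_vertex_mx_edge.
rewrite -!(chart_vertexE v'_indep BB FB).
set z := chart_vertex _ _ _ _.
rewrite opprD addrACA subrr addr0 -mulmxBl.
rewrite /enorm dotvE trmx_mul mulmxA -[_ *m B *m _]mulmxA BB mulmx1 -dotvE.
rewrite /dotv big_ord1 -expr2 sqrtr_sqr [edge_mx z]mx11_scalar det_scalar1.
rewrite !mxE -normrN opprB.
by have -> : lift ord0 (0 : 'I_1) = ord_max :> 'I_2 by exact/val_inj.
Qed.

End AreaBound.

(** * The regular simplex and the bounds *)

Section Equidistant.
Context {R : realType} (k : nat) (v : 'I_k.+2 -> 'rV[R]_k.+1).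
Hypothesis v_indep : affinely_independent v.
Hypothesis v_unit : forall i, enorm (v i) = 1.
Variable l : R.
Hypothesis v_equi : forall i j, i != j -> enorm (v i - v j) = l.
Notation g := (grad v).
Let n : R := k.+1%:R.
Let N : R := k.+2%:R.

(** All pairs of distinct vertices have the same inner product [d], so [v i] has the
    same inner product with the sum of the vertices for every [i]; expanding that
    sum in the dual system shows that it is 0, whence [1 + n d = 0]. *)
Lemma equidistant_dual : \sum_i v i = 0 /\ forall i, v i = (N / n) *: g i.
Proof.
have n0 : 0 < n by exact: ltr0Sn.
have Nn : N = n + 1 by rewrite /N -natr1.
pose d := 1 - l ^+ 2 / 2.
have vd i j : i != j -> dotv (v i) (v j) = d.
  move=> ij; have := enorm_sqr (v i - v j); rewrite v_equi // dotvBl !dotvBr.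
  by rewrite !(dotv_unit v_unit) [dotv (v j) (v i)]dotvC /d => ->; field.
have vw i : dotv (v i) (\sum_j v j) = 1 + n * d.
  rewrite dotv_sumr (bigD1_ord i) //= (dotv_unit v_unit).
  under eq_bigr do rewrite vd ?neq_lift //.
  by rewrite sumr_const card_ord -[_ *+ _]mulr_natr mulrC.
have w0 : \sum_j v j = 0.
  rewrite -(vertex_dual v_indep (\sum_j v j)); under eq_bigr do rewrite vw.
  by rewrite -scaler_sumr grad_sum // scaler0.
split=> // i.
have nd : 1 + n * d = 0 by rewrite -(vw i) w0 dotv0r.
have -> : N / n = 1 - d.
  by apply: (mulIf (lt0r_neq0 n0)); rewrite divfK ?gt_eqF // Nn; lra.
rewrite -[LHS](vertex_dual v_indep) (bigD1_ord i) //= (dotv_unit v_unit) scale1r.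
under eq_bigr do rewrite vd 1?eq_sym ?neq_lift //.
have := grad_sum v_indep; rewrite (bigD1_ord i) //= => /eqP; rewrite addrC addr_eq0 => /eqP gs.
by rewrite -scaler_sumr gs scalerN -{1}[g i]scale1r -scalerBl.
Qed.

Lemma equidistant_grad_norm i : enorm (g i) = n / N.
Proof.
have [_ vg] := equidistant_dual.
have n0 : 0 < n by exact: ltr0Sn.
have N0 : 0 < N by exact: ltr0Sn.
have Nn0 : 0 < N / n by exact: divr_gt0.
have := v_unit i; rewrite vg enormZ ger0_norm ?(ltW Nn0) // => h.
apply: (mulfI (lt0r_neq0 Nn0)); rewrite h mulrA divfK ?gt_eqF // mulfV //.
by rewrite gt_eqF.
Qed.

Lemma equidistant_gradsum : gradsum v = n.
Proof.
have N0 : 0 < N by exact: ltr0Sn.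
rewrite /gradsum; under eq_bigr do rewrite equidistant_grad_norm.
by rewrite sumr_const card_ord -[_ *+ _]mulr_natr divfK // gt_eqF.
Qed.

Lemma equidistant_area : (`|\det (vertex_mx v)| * gradsum v) ^+ 2 = max_area_sqr k.
Proof.
have [w0 vg] := equidistant_dual.
have n0 : 0 < n by exact: ltr0Sn.
have cE : centered v = (N / n) *: grad_mx v.
  apply/row_matrixP => i; rewrite linearZ /= !rowK -vg /centroid w0.
  by rewrite scaler0 subr0.
have SE : scatter v = (N / n)%:M.
  rewrite /scatter {1}cE linearZ /= -scalemxAl grad_centered //.
  by rewrite scalemx1.
rewrite equidistant_gradsum exprMn det_scatter // SE det_scalar /max_area_sqr exprS.
by rewrite -/n -/N; field; rewrite gt_eqF.
Qed.

End Equidistant.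

Section AreaEquality.
Context {R : realType}.

(** On the line every simplex is regular; in the plane equality gives equal
    gradient norms, that is equal edges; in higher dimension it gives a scalar
    scatter matrix. *)
Lemma area_eq_equidistant k (v : 'I_k.+2 -> 'rV[R]_k.+1) :
  affinely_independent v -> (forall i, enorm (v i) = 1) ->
  (`|\det (vertex_mx v)| * gradsum v) ^+ 2 = max_area_sqr k ->
  exists l, forall i j, i != j -> enorm (v i - v j) = l.
Proof.
case: k v => [|[|k]] v v_indep v_unit eqn.
- exists (enorm (v ord0 - v ord_max)) => i j.
  have [i' ->|->] := unliftP ord0 i; have [j' ->|->] := unliftP ord0 j => //.
  + by rewrite (ord1 i') (ord1 j') eqxx.
  + rewrite (ord1 i') => _; rewrite -enormN opprB; congr (enorm (_ - v _)); exact/val_inj.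
  + by rewrite (ord1 j') => _; congr (enorm (_ - v _)); exact/val_inj.
- have G := area_eq_grad v_indep v_unit eqn.
  exists (`|\det (vertex_mx v)| * enorm (grad v ord0)) => p q pq.
  have [j jp jq] := exists_third p q (isT : (1 < 2)%N).
  rewrite (G ord0 j) -edge_length_triangle //.
  have [a pE|pE] := unliftP j p; last by rewrite pE eqxx in jp.
  have [b qE|qE] := unliftP j q; last by rewrite qE eqxx in jq.
  have ab : a != b by apply: contra_neq pq => ab; rewrite pE qE ab.
  rewrite pE qE.
  have [[aE bE]|[aE bE]] : (a = ord0 /\ b = ord_max) \/ (a = ord_max /\ b = ord0).
    case: a ab {pE} => [[|[|a]]// ia]; case: b {qE} => [[|[|b]]// ib] ab.
    - by left; split; exact/val_inj.
    - by right; split; exact/val_inj.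
  + by rewrite aE bE.
  + by rewrite aE bE -enormN opprB.
- have [c0 SE] := area_eq_scatter v_indep v_unit isT eqn.
  by eexists; exact: scalar_scatter_equidistant.
Qed.

(** [k!] times the area of the inscribed regular simplex. *)
Definition max_area k : R :=
  k.+2%:R `^ (k.+2%:R / 2) / (k.+1%:R `^ (k.+1%:R / 2 - 1)).

Lemma max_area_gt0 k : 0 < max_area k.
Proof. by rewrite divr_gt0 // powR_gt0 // ltr0n. Qed.

Lemma max_areaE k : max_area k ^+ 2 = max_area_sqr k.
Proof.
rewrite /max_area /max_area_sqr.
have [n n0 nE] : exists2 n : R, 0 < n & n = k.+1%:R by exists k.+1%:R; rewrite ?ltr0n.
have [N N0 NE] : exists2 N : R, 0 < N & N = k.+2%:R by exists k.+2%:R; rewrite ?ltr0n.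
rewrite -nE -NE.
have half (x y : R) : 0 < x -> (x `^ (y / 2)) ^+ 2 = x `^ y.
  move=> x0; rewrite expr2 -powRD; last by rewrite (gt_eqF x0) implybT.
  by rewrite -splitr.
have den : (n `^ (n / 2 - 1)) ^+ 2 * n ^+ 2 = n ^+ k.+1.
  have -> : n ^+ k.+1 = n `^ n by rewrite {3}nE powR_mulrn // ltW.
  rewrite -[n `^ n]half // -exprMn; congr (_ ^+ 2).
  transitivity (n `^ (n / 2 - 1) * n `^ 1); first by rewrite powRr1 ?ltW.
  rewrite -powRD; last by rewrite (gt_eqF n0) implybT.
  by rewrite subrK.
have num : (N `^ (N / 2)) ^+ 2 = N ^+ k.+2.
  by rewrite half // {2}NE powR_mulrn // ltW.
have d0 : 0 < n `^ (n / 2 - 1) by rewrite powR_gt0.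
rewrite expr_div_n num.
have -> : (n `^ (n / 2 - 1)) ^+ 2 = n ^+ k / n.
  apply: (mulIf (x := n ^+ 2)); first by rewrite expf_neq0 // gt_eqF.
  by rewrite den exprS; field; rewrite gt_eqF.
rewrite expr_div_n !exprS.
by field; rewrite expf_neq0 gt_eqF.
Qed.

Lemma max_areaS k :
  k.+2%:R `^ ((k.+1%:R - 1) / 2) / (k.+1%:R `^ (k.+1%:R / 2 - 1)) =
  max_area k / k.+2%:R.
Proof.
rewrite /max_area [RHS]mulrAC; congr (_ / _).
have N0 : 0 < k.+2%:R :> R by rewrite ltr0n.
apply: (mulIf (lt0r_neq0 N0)); rewrite divfK ?gt_eqF //.
transitivity (k.+2%:R `^ ((k.+1%:R - 1) / 2) * k.+2%:R `^ 1 : R).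
  by rewrite powRr1 ?ltW.
rewrite -powRD; last by rewrite (gt_eqF N0) implybT.
by congr (_ `^ _); rewrite -natr1; field.
Qed.

End AreaEquality.

Section InscribedSimplex.
Context {R : realType} (k : nat) (v : 'I_k.+2 -> 'rV[R]_k.+1).
Hypothesis v_indep : affinely_independent v.
Hypothesis v_unit : forall i, enorm (v i) = 1.
Hypothesis v_pos : forall i, 0 < bary v 0 i.
Variable phi : R -> R.
Hypothesis phi_gt0 : forall x : R, 0 < x -> 0 < phi x.
Hypothesis phi_concave : concave_function `]0, +oo[ phi.
Hypothesis phi_incr : {in `]0, +oo[ &, {homo phi : x y / x <= y}}.
Notation g := (grad v).
Notation a := (`|\det (vertex_mx v)|).
Notation s := (gradsum v).
Notation T := (simplex_of v).
Let n : R := k.+1%:R.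
Let N : R := k.+2%:R.
Let f : R := k`!%:R.

Lemma phi_le x y : 0 < x -> x <= y -> phi x <= phi y.
Proof.
move=> x0 xy; apply: phi_incr => //; rewrite in_itv /= andbT //.
exact: lt_le_trans xy.
Qed.

Lemma Sg_simplex : Sg phi T = a / f * \sum_j enorm (g j) * phi (bary v 0 j / enorm (g j)).
Proof.
rewrite /Sg sum_facets // mulr_sumr; apply: eq_bigr => j _.
rewrite set_dist_facet // kvol_facet // ger0_norm ?ltW // /f; ring.
Qed.

Lemma Sg_in_simplex : Sg_in phi T = s^-1 * \sum_j phi (a * enorm (g j) / f).
Proof.
rewrite /Sg_in sum_facets // mulr_sumr; apply: eq_bigr => j _.
by rewrite set_dist_incenter // kvol_facet.
Qed.

Let f0 : 0 < f. Proof. by rewrite ltr0n fact_gt0. Qed.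
Let s0 : 0 < s. Proof. exact: gradsum_gt0. Qed.
Let a0 : 0 < a. Proof. exact: vol_factor_gt0. Qed.
Let n0 : 0 < n. Proof. exact: ltr0Sn. Qed.
Let N0 : 0 < N. Proof. exact: ltr0Sn. Qed.

Lemma area_le_max : a * s <= max_area k.
Proof.
rewrite -(ler_pXn2r (n := 2)) ?nnegrE ?max_areaE ?area_le //; apply: ltW.
  exact: mulr_gt0.
exact: max_area_gt0.
Qed.

(** Jensen's inequality with weights [|g j|] at the distances [bary v 0 j / |g j|];
    the weighted distances add up to 1. *)
Lemma Sg_le_area : Sg phi T <= a * s / f * phi (1 / n).
Proof.
rewrite Sg_simplex.
have gj0 j : 0 < enorm (g j) by exact: grad_norm_gt0.
have := jensen phi_concave gj0 (fun j => divr_gt0 (v_pos j) (gj0 j)).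
under [X in _ <= _ * phi (X / _)]eq_bigr => j _.
  rewrite mulrC divfK ?gt_eqF //.
  over.
rewrite bary_sum // -/s => h.
have af0 : 0 <= a / f by rewrite divr_ge0 // ltW.
apply: (le_trans (ler_wpM2l af0 h)).
rewrite [a * s / f]mulrAC -[a / f * s * _]mulrA ler_pM2l ?divr_gt0 // ler_pM2l //.
by apply: phi_le; rewrite ?divr_gt0 // !div1r lef_pV2 ?posrE // gradsum_ge.
Qed.

(** Jensen's inequality with equal weights at the facet volumes. *)
Lemma Sg_in_le : Sg_in phi T <= N / s * phi (max_area k / N / f).
Proof.
have x0 j : 0 < a * enorm (g j) / f.
  by rewrite divr_gt0 // mulr_gt0 // grad_norm_gt0.
have := jensen phi_concave (fun _ : 'I_k.+2 => ltr01) x0.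
under eq_bigr do rewrite mul1r.
under [X in _ <= _ * phi (X / _)]eq_bigr do rewrite mul1r.
rewrite sumr_const card_ord -/N -mulr_suml -mulr_sumr -/s => h.
rewrite Sg_in_simplex [N / s]mulrC -[s^-1 * N * _]mulrA ler_pM2l ?invr_gt0 //.
apply: (le_trans h); rewrite ler_pM2l //; apply: phi_le.
  by rewrite !divr_gt0 // mulr_gt0.
by rewrite mulrAC !ler_pM2r ?invr_gt0 // area_le_max.
Qed.

(** Equality in the bound forces the area to be maximal, because [phi (1 / n)] is
    positive; for a regular simplex all distances to the facets are [1 / n]. *)
Theorem Sg_bound : Sg phi T <= max_area k / f * phi (1 / n) /\
  (Sg phi T = max_area k / f * phi (1 / n) <->
   exists l, forall i j, i != j -> enorm (v i - v j) = l).
Proof.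
have pn : 0 < phi (1 / n) by apply: phi_gt0; rewrite divr_gt0.
have le2 : a * s / f * phi (1 / n) <= max_area k / f * phi (1 / n).
  by rewrite ler_pM2r // ler_pM2r ?invr_gt0 // area_le_max.
split; first exact: le_trans Sg_le_area le2.
split=> [eqn|[l v_equi]].
  apply: area_eq_equidistant => //; rewrite -max_areaE; congr (_ ^+ 2).
  have fp : 0 < f^-1 * phi (1 / n) by rewrite mulr_gt0 ?invr_gt0.
  apply/eqP; rewrite eq_le area_le_max /= -(ler_pM2r fp) !mulrA -eqn.
  exact: Sg_le_area.
have aE : a * s = max_area k.
  apply: (pexpIrn (n := 2)) => //; rewrite ?nnegrE.
  - by rewrite ltW ?mulr_gt0.
  - by rewrite ltW ?max_area_gt0.
  - by rewrite max_areaE (equidistant_area v_indep v_unit v_equi).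
have sE := equidistant_gradsum v_indep v_unit v_equi.
have [w _] := equidistant_dual v_indep v_unit v_equi.
rewrite Sg_simplex -aE.
have cE j : bary v 0 j = N^-1.
  have := bary_centroid v_indep j; by rewrite /centroid w scaler0.
have G j : enorm (g j) = n / N := equidistant_grad_norm v_indep v_unit v_equi j.
have hE j : bary v 0 j / enorm (g j) = 1 / n by rewrite cE G; field; rewrite !gt_eqF.
under eq_bigr do rewrite hE.
by rewrite -mulr_suml -/s; ring.
Qed.

(** Equality forces the inradius to be maximal; for a regular simplex the facet
    volumes are all equal. *)
Theorem Sg_in_bound : Sg_in phi T <= N / n * phi (max_area k / N / f) /\
  (Sg_in phi T = N / n * phi (max_area k / N / f) <->
   exists l, forall i j, i != j -> enorm (v i - v j) = l).
Proof.
have x0 : 0 < max_area k / N / f by rewrite !divr_gt0 // max_area_gt0.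
have px := phi_gt0 x0.
have le2 : N / s * phi (max_area k / N / f) <= N / n * phi (max_area k / N / f).
  by rewrite ler_pM2r // ler_pM2l // lef_pV2 ?posrE // gradsum_ge.
split; first exact: le_trans Sg_in_le le2.
split=> [eqn|[l v_equi]].
  apply: gradsum_eq => //; apply/eqP; rewrite eq_le gradsum_ge // andbT.
  rewrite -(lef_pV2 (x := n)) ?posrE // -(ler_pM2l N0) -(ler_pM2r px) -eqn.
  exact: Sg_in_le.
have aE : a * s = max_area k.
  apply: (pexpIrn (n := 2)) => //; rewrite ?nnegrE.
  - by rewrite ltW ?mulr_gt0.
  - by rewrite ltW ?max_area_gt0.
  - by rewrite max_areaE (equidistant_area v_indep v_unit v_equi).
have sE := equidistant_gradsum v_indep v_unit v_equi.
rewrite Sg_in_simplex -aE sE.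
have G j : enorm (g j) = n / N := equidistant_grad_norm v_indep v_unit v_equi j.
under eq_bigr do rewrite G.
rewrite sumr_const card_ord -[phi _ *+ _]mulr_natr -/N -/n [a * (n / N)]mulrA.
by set X := phi _; rewrite [X * N]mulrC mulrA [n^-1 * N]mulrC.
Qed.

End InscribedSimplex.

Theorem corollary3p2 (R : realType) (n : nat) (n_gt0 : (0 < n)%N)
    (phi : R -> R)
    (phi_gt0 : forall x : R, 0 < x -> 0 < phi x)
    (phi_concave : concave_function `]0, +oo[ phi)
    (phi_incr : {in `]0, +oo[ &, {homo phi : x y / x <= y}})
    (T : set 'rV[R]_n)
    (T_inscribed : inscribed_polytope_o T)
    (T_simplex : simplex T) :
  let b : R := n.+1%:R `^ (n.+1%:R / 2)
               / (n%:R `^ (n%:R / 2 - 1) * (n.-1)`!%:R) * phi (1 / n%:R) in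
  let b_in : R := n.+1%:R / n%:R
               * phi (n.+1%:R `^ ((n%:R - 1) / 2)
                      / (n%:R `^ (n%:R / 2 - 1) * (n.-1)`!%:R)) in
  (Sg phi T <= b /\ (Sg phi T = b <-> regular_simplex T)) /\
  (Sg_in phi T <= b_in /\ (Sg_in phi T = b_in <-> regular_simplex T)).
Proof.
case: n n_gt0 T T_inscribed T_simplex => [//|k] _ T T_inscribed T_simplex b b_in.
have bE : b = max_area k / k`!%:R * phi (1 / k.+1%:R) by rewrite /b invfM mulrA.
have b_inE : b_in = k.+2%:R / k.+1%:R * phi (max_area k / k.+2%:R / k`!%:R).
  by rewrite /b_in -max_areaS invfM mulrA.
have spanP v : spanned_simplex v T -> [/\ affinely_independent v, T = simplex_of v,
    forall i, enorm (v i) = 1 & forall i, 0 < bary v 0 i].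
  move=> [v_indep TE].
  have {}TE : T = simplex_of v by rewrite TE convex_hull_simplex.
  have [[_ T0] Tvert] := T_inscribed; split => // i.
    by apply: Tvert; rewrite TE; exact: vertex_simplex_of.
  by apply: interior_bary => //; rewrite -TE.
have regularP v : spanned_simplex v T ->
    (exists l, forall i j, i != j -> enorm (v i - v j) = l) -> regular_simplex T.
  by move=> vT vl; exists v.
have [v vT] := T_simplex; have [v_indep TE v_unit v_pos] := spanP v vT.
rewrite bE b_inE; split.
  have [le eqv] := Sg_bound v_indep v_unit v_pos phi_gt0 phi_concave phi_incr.
  rewrite {1 2}TE; split=> //; split; first by move/eqv; exact: regularP.
  move=> [w [wT wl]]; have [w_indep TE' w_unit w_pos] := spanP w wT.
  rewrite -TE TE'.
  by have [_ [_ ->]] := Sg_bound w_indep w_unit w_pos phi_gt0 phi_concave phi_incr.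
have [le eqv] := Sg_in_bound v_indep v_unit phi_gt0 phi_concave phi_incr.
rewrite {1 2}TE; split=> //; split; first by move/eqv; exact: regularP.
move=> [w [wT wl]]; have [w_indep TE' w_unit w_pos] := spanP w wT.
rewrite -TE TE'.
by have [_ [_ ->]] := Sg_in_bound w_indep w_unit phi_gt0 phi_concave phi_incr.
Qed.
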